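(* For any parameter $\alpha\in\mathbb S^1\setminus\Omega$, every regular parabolic or loxodromic isometry in $\mathrm{PU}(2,1)$ admits an $\alpha^{(3)}$-decomposition.
   Context: $V$ is a 3-dimensional complex vector space with a Hermitian form $\langle\cdot,\cdot\rangle$ of signature $++-$. A point of $\mathbb PV$ and a representative in $V$ are denoted by the same letter; $p\in\mathbb PV$ is negative, isotropic or positive according to $\langle p,p\rangle<0$, $=0$, $>0$; $\mathrm SV$ is the set of isotropic points. $\mathrm{SU}(2,1)$ is the group of determinant-one linear automorphisms of $V$ preserving the form, $\Omega=\{1,\omega,\omega^2\}$, $\omega=e^{2\pi i/3}$, $\mathrm{PU}(2,1)=\mathrm{SU}(2,1)/\Omega$; elements are called isometries. $\mathbb S^1$ is the set of unit complex numbers. For $p\in\mathbb PV\setminus\mathrm SV$ and $\alpha\in\mathbb S^1\setminus\Omega$, $R_\alpha^p\in\mathrm{SU}(2,1)$ is $R_\alpha^p x=(\alpha^{-2}-\alpha)\frac{\langle x,p\rangle}{\langle p,p\rangle}p+\alpha x$. An isometry in $\mathrm{PU}(2,1)$ admits an $\alpha^{(3)}$-decomposition if it has a lift $F\in\mathrm{SU}(2,1)$ with $F=R_\alpha^{p_3}R_\alpha^{p_2}R_\alpha^{p_1}$ for some $p_1,p_2,p_3\in\mathbb PV\setminus\mathrm SV$. A nonidentical isometry is elliptic if it fixes a negative point, parabolic if it fixes exactly one isotropic point and is not elliptic, loxodromic if it fixes exactly two isotropic points and is not elliptic. An isometry is regular if its eigenspaces (those of a lift) have dimension $1$. *)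

(* Defs.v *)
From HB Require Import structures.
From mathcomp Require Import all_boot all_order all_algebra.
From mathcomp Require Import all_classical reals trigo.
From mathcomp Require Import complex.
Set Implicit Arguments.
Unset Strict Implicit.
Unset Printing Implicit Defensive.
Import Order.TTheory GRing.Theory Num.Theory passmx.
Local Open Scope classical_set_scope.
Local Open Scope ring_scope.

(* A Hermitian form on V is linear in its first argument and conjugate-linear
   in its second one. *)
Notation hermitian_form R V :=
  ({hermitian V for false & @Num.conj R[i]}) (only parsing).

Definition omega (R : realType) : R[i] :=
  Complex (cos (2%:R * pi / 3%:R)) (sin (2%:R * pi / 3%:R)).

Definition Omega (R : realType) : set R[i] :=
  [set x | [\/ x = 1, x = omega R | x = omega R ^+ 2]].

(* Signature ++-: the form is diagonal, with signs +, +, -, in some basis. *)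
Definition signature_ppm (R : realType) (V : vectType R[i])
    (h : hermitian_form R V) : Prop :=
  exists e : 3.-tuple V,
    [/\ basis_of fullv e,
        forall i j : 'I_3, i != j -> h e`_i e`_j = 0,
        0 < h e`_0 e`_0, 0 < h e`_1 e`_1 & h e`_2 e`_2 < 0].

(* The projective space: points are the lines of V. *)
Definition PV (R : realType) (V : vectType R[i]) : Type :=
  {p : {vspace V} | \dim p == 1%N}.

(* A nonzero vector of the line p. The signs below and the reflections do not
   depend on its choice. *)
Definition rep (R : realType) (V : vectType R[i]) (p : PV V) : V :=
  vpick (val p).

Definition negative (R : realType) (V : vectType R[i])
  (h : hermitian_form R V) (p : PV V) : Prop := h (rep p) (rep p) < 0.

Definition isotropic (R : realType) (V : vectType R[i])
  (h : hermitian_form R V) (p : PV V) : Prop := h (rep p) (rep p) = 0.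

Definition det_end (R : realType) (V : vectType R[i]) (F : 'End(V)) : R[i] :=
  \det (mxof (vbasis {:V}) (vbasis {:V}) F).

Definition SU (R : realType) (V : vectType R[i]) (h : hermitian_form R V) :
    set 'End(V) :=
  [set F | det_end F = 1 /\ forall x y, h (F x) (F y) = h x y].

Definition Omega_coset (R : realType) (V : vectType R[i]) (F : 'End(V)) :
  set 'End(V) := [set d *: F | d in @Omega R].

(* An element of PU = SU / Omega is a coset; its elements are its lifts. *)
Definition PU (R : realType) (V : vectType R[i]) (h : hermitian_form R V) :
  set (set 'End(V)) := [set Omega_coset F | F in SU h].

Definition nonidentical (R : realType) (V : vectType R[i])
  (f : set 'End(V)) : Prop := f <> Omega_coset \1%VF.

Definition fixes (R : realType) (V : vectType R[i]) (f : set 'End(V))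
  (p : PV V) : Prop := exists2 F, f F & (F @: val p)%VS = val p.

Definition fixed_isotropic (R : realType) (V : vectType R[i])
    (h : hermitian_form R V) (f : set 'End(V)) : set (PV V) :=
  [set p | isotropic h p /\ fixes f p].

Definition elliptic (R : realType) (V : vectType R[i])
    (h : hermitian_form R V) (f : set 'End(V)) : Prop :=
  nonidentical f /\ exists p : PV V, negative h p /\ fixes f p.

Definition parabolic (R : realType) (V : vectType R[i])
    (h : hermitian_form R V) (f : set 'End(V)) : Prop :=
  [/\ nonidentical f,
      exists p, fixed_isotropic h f = [set p] &
      ~ elliptic h f].

Definition loxodromic (R : realType) (V : vectType R[i])
    (h : hermitian_form R V) (f : set 'End(V)) : Prop :=
  [/\ nonidentical f,
      exists p q, p <> q /\ fixed_isotropic h f = [set p; q] &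
      ~ elliptic h f].

Definition regular (R : realType) (V : vectType R[i])
    (f : set 'End(V)) : Prop :=
  exists2 F, f F &
    forall a, leigenvalue F a -> \dim (leigenspace F a) = 1%N.

Definition refl_fun (R : realType) (V : vectType R[i])
    (h : hermitian_form R V) (alpha : R[i]) (p : PV V) (x : V) : V :=
  ((alpha ^- 2 - alpha) * (h x (rep p) / h (rep p) (rep p))) *: rep p
    + alpha *: x.

Fact refl_fun_is_linear (R : realType) (V : vectType R[i])
  (h : hermitian_form R V) (alpha : R[i]) (p : PV V) :
  linear (refl_fun h alpha p).
Proof.
move=> a x y; rewrite /refl_fun linearPl /= [a *: (_ + _)]scalerDr !scalerA.
rewrite addrACA -scalerDl scalerDr scalerA [alpha * a]mulrC; congr (_ *: _ + _).
by rewrite [(_ + _) / _]mulrDl mulrDr -mulrA (mulrCA _ a).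
Qed.

HB.instance Definition _ (R : realType) (V : vectType R[i])
    (h : hermitian_form R V) (alpha : R[i]) (p : PV V) :=
  GRing.isSemilinear.Build R[i] V V _ (refl_fun h alpha p)
    (GRing.semilinear_linear (refl_fun_is_linear h alpha p)).

Definition refl (R : realType) (V : vectType R[i]) (h : hermitian_form R V)
  (alpha : R[i]) (p : PV V) : 'End(V) := linfun (refl_fun h alpha p).

Definition admits_alpha3_decomposition (R : realType) (V : vectType R[i])
    (h : hermitian_form R V) (alpha : R[i]) (f : set 'End(V)) : Prop :=
  exists2 F, f F & exists p1 p2 p3 : PV V,
    [/\ ~ isotropic h p1, ~ isotropic h p2, ~ isotropic h p3 &
        F = (refl h alpha p3 \o refl h alpha p2 \o refl h alpha p1)%VF].

(* Main.v *)
(* Put mu = alpha^-3 and g = mu F. Then alpha^-1 R_alpha^p is the complex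
   reflection C_p fixing the orthogonal of p and multiplying p by mu, det g =
   mu^3, and we want g = C_p C_q C_r. For a vector w put L = <w - g w, w> and
   p = w - g w; then C_p w = g w as soon as L + mu L^* = 0 and L <> 0. For such a
   w1 with center p1, the isometry C_p1^-1 g fixes w1, and it agrees with g on the
   vectors w such that <g w, w1> = <w, w1>. If one of these, w2, has the same
   property for g, a second reflection leaves an isometry fixing a plane and of
   determinant mu, which is then automatically a reflection. With nu^2 = mu the
   condition on L reads Re (nu^* L) = 0, so w2 exists if the real quadratic form
   Re (nu^* L) changes sign on the allowed vectors.

   This is applied in a basis v1, v2, v3 with v1, v2 isotropic and <v1, v2> = 1.
   A loxodromic F has lifts for which the eigenvalue k of g at v3 avoids 1, mu and
   -mu; this is enough. A parabolic F is unipotent up to a scalar, or has two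
   eigenvalues l <> k. In the second case g has eigenvalues mu th and mu th^-2,
   with th^3 <> 1, and the lift is chosen with Re th < -1/2; only when g has the
   eigenvalue 1 is it necessary to choose p1 differently, in the orthogonal plane
   of an eigenvector. *)

From HB Require Import structures.
Require Import Defs.
From mathcomp Require Import all_boot all_order all_algebra.
From mathcomp Require Import all_classical reals trigo.
From mathcomp Require Import complex.
From mathcomp Require Import ring lra.

Set Implicit Arguments.
Unset Strict Implicit.
Unset Printing Implicit Defensive.
Import Order.TTheory GRing.Theory Num.Theory passmx.
Local Open Scope ring_scope.

(** * Linear algebra in dimension three *)

(** [det_end] lives on matrices of size [\dim {:V}], which equals 3 only by a hypothesis; this gives
    an explicit basis that length. *)
Lemma cast_tuple3 (T : eqType) n (x y z : T) : n = 3%N ->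
  exists e : n.-tuple T, e = [:: x; y; z] :> seq T.
Proof. by move=> ->; exists [tuple x; y; z]. Qed.

Lemma det_end_change_basis (R : realType) (V : vectType R[i])
    (e : (\dim {:V}).-tuple V) (F : 'End(V)) : basis_of fullv e ->
  det_end F = \det (mxof e e F).
Proof.
move=> eV; have bV := vbasisP (fullv : {vspace V}); set b := vbasis _ in bV *.
have eb : mxof e b \1%VF *m mxof b e \1%VF = 1%:M.
  by rewrite -mxof_comp // comp_lfun1l mxof1 // (basis_free eV).
have -> : mxof e e F = mxof e b \1%VF *m mxof b b F *m mxof b e \1%VF.
  by rewrite -!mxof_comp // comp_lfun1l comp_lfun1r.
by rewrite !det_mulmx mulrAC -det_mulmx eb det1 mul1r.
Qed.

Lemma det_end_trig (R : realType) (V : vectType R[i]) (F : 'End(V))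
    (v1 v2 v3 : V) (a b c x y z : R[i]) :
  \dim {:V} = 3%N -> basis_of fullv [:: v1; v2; v3] ->
  F v1 = a *: v1 -> F v2 = b *: v2 + x *: v1 ->
  F v3 = c *: v3 + y *: v2 + z *: v1 -> det_end F = a * b * c.
Proof.
move=> dV vV F1 F2 F3; have [e eE] := cast_tuple3 v1 v2 v3 dV.
have eV : basis_of fullv e by rewrite eE.
have fe := basis_free eV.
have C (k : nat) (j : 'I_(\dim {:V})) : coord e j e`_k = (j == k :> nat)%:R.
  have [lk|gk] := ltnP k (\dim {:V}).
    by rewrite (coord_free (Ordinal lk) j fe) eq_sym.
  rewrite nth_default ?size_tuple // linear0.
  by rewrite ltn_eqF // (leq_trans (ltn_ord j)).
have C1 j : coord e j v1 = (j == 0%N :> nat)%:R by rewrite -C eE.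
have C2 j : coord e j v2 = (j == 1%N :> nat)%:R by rewrite -C eE.
have C3 j : coord e j v3 = (j == 2%N :> nat)%:R by rewrite -C eE.
(* Row [i] lists the coordinates of the image of the [i]-th basis vector, so the matrix is lower
   triangular. *)
have A i j : mxof e e F i j =
  (if i == 0%N :> nat then a * (j == 0%N :> nat)%:R else
   if i == 1%N :> nat then b * (j == 1%N :> nat)%:R + x * (j == 0%N :> nat)%:R
   else c * (j == 2%N :> nat)%:R + y * (j == 1%N :> nat)%:R
     + z * (j == 0%N :> nat)%:R).
  rewrite !mxE /= vecof_delta eE.
  have : (i < 3)%N by rewrite -dV.
  case: (i : nat) => [|[|[|]]] //= _; rewrite ?(F1, F2, F3).
  - by rewrite linearZ /= C1.
  - by rewrite linearD !linearZ /= C1 C2.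
  - by rewrite !linearD !linearZ /= C1 C2 C3.
rewrite (det_end_change_basis F eV) det_trig.
  transitivity (\prod_(i < \dim {:V}) [:: a; b; c]`_i).
    apply: eq_bigr => i _; rewrite A; have : (i < 3)%N by rewrite -dV.
    by case: (i : nat) => [|[|[|]]] //= _; rewrite ?(mulr0, mulr1, addr0).
  by rewrite dV !big_ord_recl big_ord0 /= mulr1 mulrA.
apply/is_trig_mxP => i j; rewrite A.
have : (i < 3)%N by rewrite -dV.
by case: (i : nat) => [|[|[|]]] //= _; case: (j : nat) => [|[|[|j0]]] //= _;
  rewrite ?(mulr0, addr0).
Qed.

Section Space.
Variables (R : realType) (V : vectType R[i]).
Hypothesis dimV : \dim {:V} = 3%N.

Lemma free3_basis (x y z : V) : free [:: x; y; z] -> basis_of fullv [:: x; y;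
  z].
Proof. by move=> fr; rewrite basisEfree fr subvf dimV. Qed.

Lemma free3_rev (x y z : V) : free [:: x; y; z] -> free [:: z; y; x].
Proof.
have E : perm_eq (rev [:: x; y; z]) [:: x; y; z] by rewrite perm_rev.
by rewrite -(perm_free E).
Qed.

Lemma free3_decomp (x y z : V) : free [:: x; y; z] ->
  forall u, exists a b c, u = a *: x + b *: y + c *: z.
Proof.
move=> /free3_basis /span_basis E u.
have : u \in <<[:: x; y; z]>>%VS by rewrite E memvf.
rewrite !span_cons span_nil addv0 => /memv_addP[_ /vlineP[a ->]].
move=> [_ /memv_addP[_ /vlineP[b ->] [_ /vlineP[c ->] ->]] ->].
by exists a, b, c; rewrite addrA.
Qed.

Lemma free_extend (X : seq V) : free X -> (size X < 3)%N ->
  exists x, free (x :: X).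
Proof.
move=> fX sX; have [/existsP|] := boolP [exists i,
  (vbasis {:V})`_(i : 'I_(\dim {:V})) \notin <<X>>%VS].
  by move=> [i xi]; exists (vbasis {:V})`_i; rewrite free_cons xi.
rewrite negb_exists => /forallP H; have : ({:V} <= <<X>>)%VS.
  rewrite -(span_basis (vbasisP {:V})); apply/span_subvP => x /(nthP 0) [j].
  by rewrite size_tuple => lj <-; have := H (Ordinal lj); rewrite negbK.
by move/dimvS; rewrite dimV leqNgt (leq_ltn_trans (dim_span X)).
Qed.

Lemma free2P (x y : V) : x != 0 -> (forall k, y <> k *: x) -> free [:: y; x].
Proof.
move=> x0 yx; rewrite free_cons seq1_free x0 andbT span_seq1.
by apply/negP => /vlineP[k /yx].
Qed.

Lemma free3P (x y z : V) : (forall a b c, a *: x + b *: y + c *: z = 0 ->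
  [/\ a = 0, b = 0 & c = 0]) -> free [:: x; y; z].
Proof.
move=> H; rewrite !free_cons span_nil nil_free memv0 andbT.
apply/and3P; split; apply/negP.
- rewrite span_cons span_seq1 => /memv_addP[_ /vlineP[b ->]].
  move=> [_ /vlineP[c ->] E]; have [] := H (-1) b c.
    by rewrite E scaleN1r -addrA addNr.
  by move/eqP; rewrite oppr_eq0 oner_eq0.
- rewrite span_seq1 => /vlineP[c E]; have [] := H 0 (-1) c.
    by rewrite scale0r add0r E scaleN1r addNr.
  by move=> _ /eqP; rewrite oppr_eq0 oner_eq0.
- move=> /eqP E; have [] := H 0 0 1; first by rewrite !scale0r !add0r E scaler0.
  by move=> _ _ /eqP; rewrite oner_eq0.
Qed.

Lemma free3_eq0 (x y z : V) a b c : free [:: x; y; z] ->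
  a *: x + b *: y + c *: z = 0 -> [/\ a = 0, b = 0 & c = 0].
Proof.
move=> fr E; have /freeP/(_ (fun i => [:: a; b; c]`_i)) := fr : free [tuple x;
  y; z].
rewrite !big_ord_recl big_ord0 /= addr0 addrA => /(_ E) K.
by have := (K ord0, K (lift ord0 ord0), K (lift ord0 (lift ord0 ord0))) => /=
  -[[]].
Qed.

Lemma det_endM (F G : 'End(V)) : det_end (F \o G)%VF = det_end F * det_end G.
Proof. by rewrite /det_end (@mxof_comp _ _ _ _ _ (vbasis {:V})) ?vbasisP //
  det_mulmx mulrC. Qed.

Lemma det_endZ a (F : 'End(V)) : det_end (a *: F) = a ^+ 3 * det_end F.
Proof. by rewrite /det_end linearZ /= detZ; congr (_ ^+ _ * _). Qed.

End Space.

(** * Unit complex numbers and phases *)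

Lemma conjE (R : realType) (a b : R) : (Complex a b)^* = Complex a (- b).
Proof. by []. Qed.

Lemma unit_neq0 (R : realType) (a : R[i]) : `|a| = 1 -> a != 0.
Proof. by move=> a1; rewrite -normr_gt0 a1. Qed.

Lemma conj_unit (R : realType) (a : R[i]) : `|a| = 1 -> a^* = a^-1.
Proof. by move=> a1; rewrite invC_norm a1 expr1n invr1 mul1r. Qed.

Section Conj.
Variable R : realType.
Implicit Types a b : R[i].

Lemma conjB a b : (a - b)^* = a^* - b^*. Proof. exact: rmorphB. Qed.
Lemma conjD a b : (a + b)^* = a^* + b^*. Proof. exact: rmorphD. Qed.
Lemma conjN a : (- a)^* = - a^*. Proof. exact: rmorphN. Qed.
Lemma conjM a b : (a * b)^* = a^* * b^*. Proof. exact: rmorphM. Qed.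
Lemma conjV a : (a^-1)^* = (a^*)^-1. Proof. exact: fmorphV. Qed.
Lemma conjX a n : (a ^+ n)^* = a^* ^+ n. Proof. exact: rmorphXn. Qed.

Definition conjsE := (conjB, conjD, conjN, conjM, conjV, conjX,
  conjC1 R[i], conjC0 R[i], conjCi R[i], @conjCK R[i]).

End Conj.

Lemma conj_realC (R : realType) (a : R) : (a%:C%C : R[i])^* = a%:C%C.
Proof. by rewrite conjE oppr0. Qed.

(* For an isometry [g] and [L = <w - g w, w>], this says that the reflection [cr
   mu p] with center [p = w - g w] maps [w] to [g w] (see [cr_good]). *)
Definition good (R : realType) (mu L : R[i]) := L != 0 /\ L = - (mu * L^*).

(** For a unit [nu] with [nu ^+ 2 = mu] it vanishes exactly when [L = - mu L^*]. Being real, it can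
    be brought to zero by a sign change. *)
Definition phase (R : realType) (nu L : R[i]) : R :=
  complex.Re (nu^* * L).

Lemma norm1P (R : realType) (a : R[i]) :
  `|a| = 1 -> complex.Re a ^+ 2 + complex.Im a ^+ 2 = 1.
Proof.
move=> a1; apply: (@complexI R).
by rewrite add_Re2_Im2 a1 expr1n.
Qed.

Lemma phase_good (R : realType) (nu L : R[i]) : `|nu| = 1 ->
  L != 0 -> phase nu L = 0 -> good (nu ^+ 2) L.
Proof.
case: nu L => n1 n2 [a b] /norm1P /= N L0; rewrite /phase conjE /= => J;
  split=> //.
rewrite conjE expr2; simpc; congr Complex.
  transitivity (a * (n1 ^+ 2 + n2 ^+ 2) - 2 * n1 * (n1 * a - - n2 * b)).
    by rewrite N J mulr1 mulr0 subr0.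
  ring.
transitivity (b * (n1 ^+ 2 + n2 ^+ 2) - 2 * n2 * (n1 * a - - n2 * b)).
  by rewrite N J mulr1 mulr0 subr0.
ring.
Qed.

(* The phase of the combination is a quadratic polynomial in [t] which changes
   sign; if the combination vanished at both roots, [a] would be a real multiple
   of [b]. *)
Lemma good_combination (R : realType) (nu a b m : R[i]) : `|nu| = 1 ->
  phase nu a * phase nu b < 0 -> complex.Im (a * b^*) != 0 ->
  exists t : R, good (nu ^+ 2) (a + t%:C%C * m + t%:C%C ^+ 2 * b).
Proof.
move=> nu1 sgn npar.
pose A := phase nu a; pose B := phase nu b; pose M := phase nu m.
have jE (t : R) : phase nu (a + t%:C%C * m + t%:C%C ^+ 2 * b) =
  A + t * M + t ^+ 2 * B.
  rewrite /A /B /M /phase; case: (nu) a b m {nu1 sgn npar A B M} =>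
    n1 n2 [a1 a2] [b1 b2] [m1 m2].
  rewrite conjE expr2; simpc; rewrite /=; ring.
have B0 : B != 0 by apply: contraTneq sgn; rewrite -/B => ->;
  rewrite mulr0 ltxx.
have D0 : 0 < M ^+ 2 - 4 * A * B by move: sgn; rewrite -/A -/B => s;
  have := sqr_ge0 M; nra.
pose s := Num.sqrt (M ^+ 2 - 4 * A * B).
have s2 : s ^+ 2 = M ^+ 2 - 4 * A * B by rewrite sqr_sqrtr // ltW.
have s0 : s != 0 by rewrite sqrtr_eq0 -ltNge.
pose t1 := (- M + s) / (2 * B); pose t2 := (- M - s) / (2 * B).
have tsum : t1 + t2 = - M / B by rewrite /t1 /t2; field.
have tprod : t1 * t2 * B = A.
  have -> : t1 * t2 * B = (M ^+ 2 - s ^+ 2) / (4 * B) by rewrite /t1 /t2; field.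
  by rewrite s2; field.
have t12 : t1 - t2 != 0.
  by rewrite (_ : t1 - t2 = s / B) ?mulf_neq0 ?invr_neq0 // /t1 /t2; field.
have J1 : A + t1 * M + t1 ^+ 2 * B = 0.
  rewrite -tprod (_ : M = - (t1 + t2) * B); first by ring.
  by rewrite tsum; field.
have J2 : A + t2 * M + t2 ^+ 2 * B = 0.
  rewrite -tprod (_ : M = - (t1 + t2) * B); first by ring.
  by rewrite tsum; field.
have [z1|z1] := eqVneq (a + t1%:C%C * m + t1%:C%C ^+ 2 * b) 0; last first.
  by exists t1; apply: phase_good => //; rewrite jE.
have [z2|z2] := eqVneq (a + t2%:C%C * m + t2%:C%C ^+ 2 * b) 0; last first.
  by exists t2; apply: phase_good => //; rewrite jE.
case/negP: npar; suff -> : a = (t1 * t2)%:C%C * b.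
  case: (b) => b1 b2; rewrite conjE; simpc => /=; apply/eqP; ring.
clearbody t1 t2; have t12C : (t1 - t2)%:C%C != 0 :> R[i] by rewrite fmorph_eq0.
apply: (mulfI t12C); apply/eqP; rewrite -subr_eq0.
(* The middle coefficient [m] is eliminated between the two vanishing combinations. *)
have -> : (t1 - t2)%:C%C * a - (t1 - t2)%:C%C * ((t1 * t2)%:C%C * b) =
  t1%:C%C * (a + t2%:C%C * m + t2%:C%C ^+ 2 * b)
  - t2%:C%C * (a + t1%:C%C * m + t1%:C%C ^+ 2 * b).
  by rewrite rmorphB rmorphM; ring.
by rewrite z1 z2 !mulr0 subrr.
Qed.

Lemma good_real (R : realType) (mu : R[i]) (r : R) : `|mu| = 1 -> mu != 1 ->
  r != 0 -> good mu ((1 - mu) * r%:C%C).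
Proof.
move=> mu1 mun1 r0; split.
  by rewrite mulf_neq0 ?fmorph_eq0 // subr_eq0 eq_sym.
rewrite !conjsE conj_realC (conj_unit mu1); field; exact: unit_neq0.
Qed.

(* [C] is the imaginary part of [1 / (1 - mu)], whose real part is [1/2]. *)
Lemma unit_half_cot (R : realType) (mu : R[i]) : `|mu| = 1 -> mu != 1 ->
  exists C : R, mu * Complex (2^-1) C = Complex (- 2^-1) C.
Proof.
case: mu => u v /norm1P /= N /eqP mun1.
have u1 : 1 - u != 0.
  apply: contra_notN mun1 => /eqP; subst; move=> /eqP;
    rewrite subr_eq0 => /eqP u1.
  have : v ^+ 2 = 0 by rewrite -u1 in N; lra.
  by move/eqP; rewrite sqrf_eq0 => /eqP ->; rewrite -u1.
exists (v / (2 * (1 - u))); simpc; congr Complex; last by field.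
have V : v ^+ 2 = (1 - u) * (1 + u) by transitivity (1 - u ^+ 2); [rewrite -N;
  ring | ring].
apply: (mulfI u1); rewrite mulrBr [X in _ - X](_ : _ = v ^+ 2 / 2);
  last by field.
by rewrite V; field.
Qed.

(** * Products of complex reflections *)

Section Form.
Variables (R : realType) (V : vectType R[i]) (h : hermitian_form R V).

Lemma hDl x y z : h (x + y) z = h x z + h y z. Proof. exact: linearDl. Qed.
Lemma hDr x y z : h x (y + z) = h x y + h x z. Proof. exact: linearDr. Qed.
Lemma hNl x y : h (- x) y = - h x y. Proof. exact: linearNl. Qed.
Lemma hBl x y z : h (x - y) z = h x z - h y z. Proof. exact: linearBl. Qed.
Lemma hBr x y z : h x (y - z) = h x y - h x z. Proof. exact: linearBr. Qed.
Lemma hZl a x y : h (a *: x) y = a * h x y. Proof. exact: linearZl_LR. Qed.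
Lemma hZr a x y : h x (a *: y) = a^* * h x y. Proof. exact: linearZr_LR. Qed.
Lemma h0l x : h 0 x = 0. Proof. exact: linear0l. Qed.
Lemma h0r x : h x 0 = 0. Proof. exact: linear0r. Qed.
Lemma hC x y : h x y = (h y x)^*. Proof. by rewrite hermC expr0 mul1r. Qed.

(* [cr mu p] is the complex reflection of angle [mu] about [p], i.e.
   [alpha^-1 R_alpha^p] for [mu = alpha^-3]; it is the identity if [p] is
   isotropic, because of the division by zero. *)
Definition cr_fun (mu : R[i]) (p x : V) : V :=
  x + ((mu - 1) * (h x p / h p p)) *: p.

Fact cr_fun_is_linear mu p : linear (cr_fun mu p).
Proof.
move=> a x y; rewrite /cr_fun hDl hZl scalerDr scalerA addrACA; congr (_ + _).
by rewrite -scalerDl; congr (_ *: _); set i := (h p p)^-1; ring.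
Qed.

HB.instance Definition _ mu p :=
  GRing.isSemilinear.Build R[i] V V _ (cr_fun mu p)
    (GRing.semilinear_linear (cr_fun_is_linear mu p)).

Definition cr mu p : 'End(V) := linfun (cr_fun mu p).

Lemma crE mu p x : cr mu p x = x + ((mu - 1) * (h x p / h p p)) *: p.
Proof. by rewrite lfunE. Qed.

Definition isometry (g : 'End(V)) := forall x y, h (g x) (g y) = h x y.

Lemma cr_id mu p x : h x p = 0 -> cr mu p x = x.
Proof. by move=> E; rewrite crE E mul0r mulr0 scale0r addr0. Qed.

Lemma crK mu p x : mu != 0 -> h p p != 0 -> cr mu p (cr mu^-1 p x) = x.
Proof.
move=> mu0 p0; rewrite !crE hDl hZl -addrA -scalerDl.
rewrite [X in X *: _](_ : _ = 0) ?scale0r ?addr0 //.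
by field; apply/andP; split.
Qed.

Lemma cr_isometry mu p : `|mu| = 1 -> isometry (cr mu p).
Proof.
move=> mu1 x y; have [p0|p0] := eqVneq (h p p) 0.
  by rewrite !crE p0 invr0 !mulr0 !scale0r !addr0.
rewrite !crE !(hDl, hDr, hZl, hZr) !rmorphM /= rmorphB rmorph1 fmorphV /=.
rewrite -!hC (conj_unit mu1).
by field; rewrite p0 unit_neq0.
Qed.

Hypothesis dimV : \dim {:V} = 3%N.
Hypothesis ndg : forall x, (forall y, h x y = 0) -> x = 0.

Lemma det_cr mu p : h p p != 0 -> det_end (cr mu p) = mu.
Proof.
move=> p0; have pn : p != 0 by apply: contraNneq p0 => ->; rewrite h0l.
have [y fy] := free_extend dimV (eq_ind_r is_true pn (seq1_free p)) isT.
have [x fx] := free_extend dimV fy isT.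
have {}fx := free3_rev fx.
rewrite (det_end_trig (a := mu) (b := 1) (c := 1) (y := 0)
  (x := (mu - 1) * (h y p / h p p)) (z :=
    (mu - 1) * (h x p / h p p)) dimV (free3_basis dimV fx)).
- by rewrite !mulr1.
- by rewrite crE divff // mulr1 scalerBl scale1r addrC subrK.
- by rewrite crE scale1r.
- by rewrite crE scale1r scale0r addr0.
Qed.

(** The determinant forces the eigenvalue [mu] on the quotient by the plane. As [mu != 1], a
    representative can be corrected to an eigenvector [p], which is orthogonal to the plane;
    nondegeneracy then makes [p] nonisotropic. *)
Lemma pointwise_fixed_plane_cr mu g u1 u2 : `|mu| = 1 -> mu != 1 ->
  isometry g -> det_end g = mu -> free [:: u2; u1] -> g u1 = u1 -> g u2 = u2 ->
  exists2 p, h p p != 0 & g = cr mu p.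
Proof.
move=> mu1 mun1 gi dg fu g1 g2.
have [x fx] := free_extend dimV fu isT.
have fx' := free3_rev fx.
have [k [b [c gx]]] := free3_decomp dimV fx (g x).
have km : k = mu.
  rewrite -dg (det_end_trig (a := 1) (b := 1) (c := k) (y := b) (x := 0) (z :=
    c) dimV (free3_basis dimV fx')) ?mul1r //.
  - by rewrite scale1r.
  - by rewrite scale1r scale0r addr0.
have m10 : mu - 1 != 0 by rewrite subr_eq0.
pose p := x + (mu - 1)^-1 *: (b *: u2 + c *: u1).
have gp : g p = mu *: p.
  rewrite /p; set q := b *: u2 + c *: u1.
  have gq : g q = q by rewrite linearD !linearZ /= g1 g2.
  have gxq : g x = mu *: x + q by rewrite gx km addrA.
  clearbody q; rewrite linearD linearZ /= gq gxq -addrA scalerDr scalerA.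
  congr (_ + _); rewrite -[X in X + _]scale1r -scalerDl; congr (_ *: _).
  by field.
have pu u : g u = u -> h p u = 0.
  move=> gu; have := gi p u; rewrite gp gu hZl => E; apply/eqP.
  by rewrite -(mulrI_eq0 _ (mulfI m10)) mulrBl mul1r E subrr.
have [p1 p2] := (pu _ g1, pu _ g2).
have fp : free [:: p; u2; u1].
  apply: free3P => a b' c' E.
  have /(free3_eq0 fx) [a0 + +] : a *: x + (a * (mu - 1)^-1 * b + b') *: u2
      + (a * (mu - 1)^-1 * c + c') *: u1 = 0.
    rewrite -E /p !scalerDl !scalerDr !scalerA -!addrA; congr (_ + (_ + _)).
    by rewrite addrCA.
  by rewrite a0 !mul0r !add0r.
clearbody p; have p0 : h p p != 0.
  apply/eqP => p0; suff pz : p = 0 by move: fp; rewrite pz free_cons mem0v.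
  apply: ndg => y; have [a' [b' [c' ->]]] := free3_decomp dimV fp y.
  by rewrite !hDr !hZr p0 p1 p2 !mulr0 !addr0.
exists p => //; apply/lfunP => y; have [a' [b' [c' ->]]] :=
  free3_decomp dimV fp y.
rewrite !linearD !linearZ /= g1 g2 gp (cr_id _ (x := u1)) ?(cr_id _ (x := u2)).
- by rewrite crE divff // mulr1 scalerBl scale1r (addrC p) subrK.
- by rewrite hC p2 conjC0.
- by rewrite hC p1 conjC0.
Qed.

(** With L = <p, w> one has <p, p> = L + L^* because g is an isometry, and the condition on L turns
    this into (1 - mu) L^*. The coefficient of [p] in the reflection of [w] is therefore -1, giving
    w - p = g w. *)
Lemma cr_good mu (g : 'End(V)) w (p := w - g w) : mu != 1 -> isometry g ->
  good mu (h p w) -> h p p != 0 /\ cr mu p w = g w.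
Proof.
move=> mu1 gi [L0 LE]; have hpp : h p p = (1 - mu) * (h p w)^*.
  rewrite {2}/p hBr (_ : h p (g w) = - h w p).
    by rewrite opprK (hC w p) mulrBl mul1r {1}LE addrC.
  by rewrite /p hBl gi hBr opprB.
have mu10 : 1 - mu != 0 by rewrite subr_eq0 eq_sym.
have p0 : h p p != 0 by rewrite hpp mulf_neq0 ?conjC_eq0.
split=> //; rewrite crE (hC w p) hpp.
have -> : (mu - 1) * ((h p w)^* / ((1 - mu) * (h p w)^*)) = -1.
  have : (h p w)^* != 0 by rewrite conjC_eq0.
  by move: (_^*) => L' L'0; field; rewrite L'0 mu10.
by rewrite scaleN1r /p subKr.
Qed.

Lemma crVK (mu : R[i]) p x : mu != 0 -> h p p != 0 ->
  cr mu^-1 p (cr mu p x) = x.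
Proof. by move=> mu0 p0; rewrite -{2}[mu]invrK crK // invr_neq0. Qed.

Lemma isometryV g (mu : R[i]) p : `|mu| = 1 -> isometry g ->
  isometry (cr (mu^-1)%R p \o g)%VF.
Proof.
by move=> mu1 gi x y; rewrite !comp_lfunE cr_isometry // normfV mu1 invr1.
Qed.

Lemma det_crV (mu : R[i]) p (g : 'End(V)) n : `|mu| = 1 -> h p p != 0 ->
  det_end g = mu ^+ n.+1 ->
  det_end (cr (mu^-1)%R p \o g)%VF = mu ^+ n.
Proof.
move=> mu1 p0 dg; rewrite det_endM det_cr // dg exprS mulKf //.
exact: unit_neq0.
Qed.

Lemma cr_factor (mu : R[i]) p (g : 'End(V)) : `|mu| = 1 -> h p p != 0 ->
  g = (cr mu p \o (cr (mu^-1)%R p \o g))%VF.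
Proof.
move=> mu1 p0; apply/lfunP => x; rewrite !comp_lfunE crK //.
exact: unit_neq0.
Qed.

(** The center p = w - g w is orthogonal to the fixed vector [u], so after removing its reflection
    both [u] and [w] are fixed and the determinant is [mu]. *)
Lemma two_cr (mu : R[i]) g (u : V) w : `|mu| = 1 -> mu != 1 -> isometry g ->
  det_end g = mu ^+ 2 -> u != 0 -> g u = u -> good mu (h (w - g w) w) ->
  exists p q, [/\ h p p != 0, h q q != 0 & g = (cr mu p \o cr mu q)%VF].
Proof.
move=> mu1 mun1 gi dg u0 gu gw; have [p0 pw] := cr_good mun1 gi gw.
set p := w - g w in p0 pw; have mu0 := unit_neq0 mu1.
have fu : free [:: w; u].
  apply: free2P => // k wk; case: gw => + _.
  by rewrite (_ : g w = w) ?subrr ?h0l ?eqxx // wk linearZ /= gu.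
have [] := @pointwise_fixed_plane_cr mu (cr (mu^-1)%R p \o g)%VF u w => //.
- exact: isometryV.
- by rewrite (det_crV (n := 1)).
- rewrite comp_lfunE gu cr_id // /p hBr -{2}gu gi subrr //.
- by rewrite comp_lfunE -pw crVK.
- by move=> q q0 gE; exists p, q; split=> //; rewrite -gE -cr_factor.
Qed.

Definition three_cr mu g := exists p q r,
  [/\ h p p != 0, h q q != 0, h r r != 0 &
      g = (cr mu p \o cr mu q \o cr mu r)%VF].

(** Once the reflection about [p] is removed, [u] is fixed and [two_cr] applies. The center [p] is
    left free here, so that it need not come from a vector satisfying [good]. *)
Lemma three_cr_reduce (mu : R[i]) g p (u : V) w : `|mu| = 1 -> mu != 1 ->
  isometry g -> det_end g = mu ^+ 3 -> h p p != 0 -> u != 0 -> cr mu p u = g u ->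
  good mu (h (w - cr mu^-1 p (g w)) w) -> three_cr mu g.
Proof.
move=> mu1 mun1 gi dg p0 u0 gu gw; have mu0 := unit_neq0 mu1.
have [] := @two_cr mu (cr (mu^-1)%R p \o g)%VF u w => //.
- exact: isometryV.
- exact: det_crV.
- by rewrite comp_lfunE -gu crVK.
- by rewrite comp_lfunE.
move=> q [r [q0 r0 E]]; exists p, q, r; split=> //.
by rewrite -comp_lfunA -E -cr_factor.
Qed.

(** The linear condition on [w2] says that [g w2] is orthogonal to the first center, so removing the
    first reflection does not change the value L at [w2]. *)
Lemma three_cr_good (mu : R[i]) g (w1 : V) w2 : `|mu| = 1 -> mu != 1 ->
  isometry g -> det_end g = mu ^+ 3 -> good mu (h (w1 - g w1) w1) ->
  h (g w2) w1 = h w2 w1 -> good mu (h (w2 - g w2) w2) -> three_cr mu g.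
Proof.
move=> mu1 mun1 gi dg gw1 w21 gw2; have [p0 pw] := cr_good mun1 gi gw1.
apply: (three_cr_reduce (p := w1 - g w1) (u := w1) (w := w2)) => //.
  by apply: contraPneq gw1 => ->; case; rewrite h0r eqxx.
by rewrite (cr_id _ (x := g w2)) // hBr gi w21 subrr.
Qed.

(** On the real line wa + t wb the value L is quadratic in t, with the polarization of L as middle
    coefficient; [good_combination] finds a suitable t. *)
Lemma three_cr_reduce_signs (nu : R[i]) (g : 'End(V)) p (u wa wb : V)
    (mu : R[i] := nu ^+ 2) (L := fun w => h (w - cr mu^-1 p (g w)) w) :
  `|nu| = 1 -> mu != 1 -> isometry g ->
  det_end g = mu ^+ 3 -> h p p != 0 -> u != 0 -> cr mu p u = g u ->
  phase nu (L wa) * phase nu (L wb) < 0 -> complex.Im (L wa * (L wb)^*) != 0 ->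
  three_cr mu g.
Proof.
move=> nu1 mun1 gi dg p0 u0 gu sgn npar.
have [t gt] := good_combination (L (wa + wb) - L wa - L wb) nu1 sgn npar.
have mu1 : `|mu| = 1 by rewrite normrX nu1 expr1n.
apply: (three_cr_reduce (w := wa + t%:C%C *: wb) mu1 mun1 gi dg p0 u0 gu).
rewrite -/(L _); congr (good _ _) : gt.
rewrite /L !linearD !linearZ /= !(hBl, hNl, hDl, hDr, hZl, hZr).
by rewrite conj_realC; ring.
Qed.

(** The same line argument, now with L taken for [g] itself: the conditions on [wa] and [wb] are
    linear and pass to every wa + t wb. *)
Lemma three_cr_signs (nu : R[i]) (g : 'End(V)) (w1 wa wb : V)
    (mu : R[i] := nu ^+ 2) (L := fun w => h (w - g w) w) :
  `|nu| = 1 -> mu != 1 -> isometry g ->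
  det_end g = mu ^+ 3 -> good mu (L w1) ->
  h (g wa) w1 = h wa w1 -> h (g wb) w1 = h wb w1 ->
  phase nu (L wa) * phase nu (L wb) < 0 -> complex.Im (L wa * (L wb)^*) != 0 ->
  three_cr mu g.
Proof.
move=> nu1 mun1 gi dg gw1 Wa Wb sgn npar.
have [t gt] := good_combination (L (wa + wb) - L wa - L wb) nu1 sgn npar.
have mu1 : `|mu| = 1 by rewrite normrX nu1 expr1n.
apply: (three_cr_good (w2 := wa + t%:C%C *: wb) mu1 mun1 gi dg gw1).
  by rewrite linearD linearZ /= !hDl !hZl Wa Wb.
rewrite -/(L _); congr (good _ _) : gt.
rewrite /L !linearD !linearZ /= !(hBl, hNl, hDl, hDr, hZl, hZr).
by rewrite conj_realC; ring.
Qed.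
End Form.

(** * Real estimates *)

Lemma phaseD (R : realType) (nu z z' : R[i]) :
  phase nu (z + z') = phase nu z + phase nu z'.
Proof. by rewrite /phase mulrDr raddfD. Qed.

Lemma Re_unit_lt1 (R : realType) (a : R[i]) : `|a| = 1 -> a != 1 ->
  complex.Re a < 1.
Proof.
case: a => x y /norm1P /= N /eqP a1; rewrite ltNge; apply/negP => x1.
have y2 := sqr_ge0 y.
have xE : x = 1 by nra.
have /eqP : y ^+ 2 = 0 by rewrite xE in N; lra.
by rewrite sqrf_eq0 => /eqP yE; apply: a1; rewrite xE yE.
Qed.

(** In s = c^2 the product is a quadratic with negative leading coefficient A B, hence negative from
    some [s0] on. The affine P s + Q cannot vanish at both [s0] and [s0 + 1]. *)
Lemma large_square (R : realType) (A B d P Q : R) :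
  A * B < 0 -> (P != 0) || (Q != 0) ->
  exists2 c : R, 0 < c &
    (A * c ^+ 2 + d) * (B * c ^+ 2 + d) < 0 /\ P * c ^+ 2 + Q != 0.
Proof.
move=> AB PQ; pose N := `|d * (A + B)| + d ^+ 2.
pose m := - (A * B); have m0 : 0 < m by rewrite oppr_gt0.
have dAB : d * (A + B) <= `|d * (A + B)| := ler_norm _.
have N0 : 0 <= N by rewrite addr_ge0 ?sqr_ge0.
pose s0 := N / m + 1.
have s1 : 1 <= s0 by rewrite lerDr divr_ge0 // ltW.
have s0E : m * s0 = N + m by rewrite /s0; field; rewrite gt_eqF.
have key (s : R) : s0 <= s -> (A * s + d) * (B * s + d) < 0.
  move=> s0s; have d2 := sqr_ge0 d; have s_ge1 : 1 <= s := le_trans s1 s0s.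
  have -> : (A * s + d) * (B * s + d) = d * (A + B) * s + d ^+ 2 - m * s * s.
    by rewrite /m; ring.
  have H1 : d * (A + B) * s <= `|d * (A + B)| * s by rewrite ler_wpM2r //; lra.
  have H2 : d ^+ 2 <= d ^+ 2 * s by rewrite ler_peMr.
  have H3 : (N + m) * s <= m * s * s.
    rewrite -s0E -!mulrA ler_pM2l // ler_wpM2r //; lra.
  have H4 : 0 < m * s by rewrite mulr_gt0 //; lra.
  by move: H3; rewrite /N; lra.
have pick (s : R) : s0 <= s -> P * s + Q != 0 -> exists2 c : R, 0 < c &
    (A * c ^+ 2 + d) * (B * c ^+ 2 + d) < 0 /\ P * c ^+ 2 + Q != 0.
  move=> s0s PQs; have s_gt0 : 0 < s by lra.
  exists (Num.sqrt s); first by rewrite sqrtr_gt0.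
  by rewrite sqr_sqrtr ?ltW //; split=> //; apply: key.
have [z0|] := eqVneq (P * s0 + Q) 0; last exact: pick.
have [z1|] := eqVneq (P * (s0 + 1) + Q) 0; last by apply: pick; lra.
have P0 : P = 0 by lra.
have Q0 : Q = 0 by rewrite P0 in z0; lra.
by rewrite P0 Q0 !eqxx in PQ.
Qed.

(** For nu = e^(ia) and l = e^(ib) the phase is cos a - cos (b - a), a product of two sines of half
    angles; squaring removes the half angles. *)
Lemma phase_sqr (R : realType) (nu l th : R[i]) : `|nu| = 1 -> `|l| = 1 ->
  l = nu ^+ 2 * th ->
  phase nu (1 - l) ^+ 2 = (1 - complex.Re l) * (1 - complex.Re th).
Proof.
move=> nu1 l1 E; have {E} -> : th = l * (nu^*) ^+ 2.
  by rewrite E (conj_unit nu1); field; exact: unit_neq0.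
case: nu l nu1 l1 => n1 n2 [a b] /norm1P /= N /norm1P /= L.
rewrite /phase conjE expr2; simpc => /=.
have b2 : b ^+ 2 = 1 - a ^+ 2 by rewrite -L; ring.
have m2 : n2 ^+ 2 = 1 - n1 ^+ 2 by rewrite -N; ring.
transitivity (n1 ^+ 2 * (1 - a) ^+ 2 - 2 * n1 * n2 * b * (1 - a) + n2 ^+ 2 * b
  ^+ 2).
  ring.
transitivity ((1 - a) * (1 - (a * (n1 ^+ 2 - n2 ^+ 2) + 2 * n1 * n2 * b))).
  by rewrite b2 m2; ring.
ring.
Qed.

(** * Isometries in normal form *)

Lemma phase_eq0 (R : realType) (nu z : R[i]) : `|nu| = 1 -> phase nu z = 0 ->
  z = - (nu ^+ 2 * z^*).
Proof.
move=> nu1 J; have [->|z0] := eqVneq z 0; first by rewrite conjC0 mulr0 oppr0.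
by case: (phase_good nu1 z0 J).
Qed.

Lemma phaseZ (R : realType) (nu z : R[i]) (r : R) :
  phase nu (r%:C%C * z) = r * phase nu z.
Proof.
by case: nu z => n1 n2 [z1 z2]; rewrite /phase conjE; simpc => /=; ring.
Qed.

Lemma Im_eq0_conj (R : realType) (z : R[i]) : complex.Im z = 0 -> z^* = z.
Proof. by case: z => a b /= ->; rewrite conjE oppr0. Qed.

Section Frame.
Variables (R : realType) (V : vectType R[i]) (h : hermitian_form R V).
Hypothesis dimV : \dim {:V} = 3%N.
Hypothesis ndg : forall x, (forall y, h x y = 0) -> x = 0.
Variables v1 v2 v3 : V.
Hypotheses (h11 : h v1 v1 = 0) (h22 : h v2 v2 = 0) (h33 : h v3 v3 = 1)
  (h12 : h v1 v2 = 1) (h13 : h v1 v3 = 0) (h23 : h v2 v3 = 0).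

Definition vec x y s : V := x *: v1 + y *: v2 + s *: v3.

Lemma h_vec x y s x' y' s' :
  h (vec x y s) (vec x' y' s') = x * y'^* + y * x'^* + s * s'^*.
Proof.
have h21 : h v2 v1 = 1 by rewrite hC h12 conjC1.
have h31 : h v3 v1 = 0 by rewrite hC h13 conjC0.
have h32 : h v3 v2 = 0 by rewrite hC h23 conjC0.
rewrite /vec !(hDl, hDr, hZl, hZr) h11 h12 h13 h21 h22 h23 h31 h32 h33.
by ring.
Qed.

Lemma vecB x y s x' y' s' :
  vec x y s - vec x' y' s' = vec (x - x') (y - y') (s - s').
Proof.
by rewrite /vec !opprD addrACA (addrACA (x *: v1)) -!scalerBl.
Qed.

Lemma lvec (g : 'End(V)) x y s :
  g (vec x y s) = x *: g v1 + y *: g v2 + s *: g v3.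
Proof. by rewrite /vec !linearD !linearZ. Qed.

(* The centers of the first two reflections come from [w1] in the span of [v1]
   and [v2], and from [v3] plus a multiple of the vector [wb] of that span; the
   sign [rho] makes the phases of [v3] and [wb] opposite. *)
Lemma loxodromic_three_cr (nu l k : R[i]) (g : 'End(V)) (mu : R[i] := nu ^+ 2) :
  `|nu| = 1 -> mu != 1 -> isometry h g -> det_end g = mu ^+ 3 ->
  l != 0 -> l * l^* != 1 -> `|k| = 1 -> l * k = mu ^+ 3 * l^* ->
  k != 1 -> k ^+ 2 != mu ^+ 2 ->
  g v1 = l *: v1 -> g v2 = l^*^-1 *: v2 -> g v3 = k *: v3 ->
  three_cr h mu g.
Proof.
move=> nu1 mun1 gi dg l0 ll1 k1 lk kn1 k2 g1 g2 g3.
have gE x y s : g (vec x y s) = vec (l * x) (l^*^-1 * y) (k * s).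
  by rewrite lvec g1 g2 g3 !scalerA !(mulrC l) (mulrC _^-1) (mulrC k).
have LE x y s : h (vec x y s - g (vec x y s)) (vec x y s) =
    (1 - l) * x * y^* + (1 - l^*^-1) * y * x^* + (1 - k) * s * s^*.
  by rewrite gE vecB h_vec; ring.
have mu0 : mu != 0 by rewrite expf_neq0 // unit_neq0.
have nu0 := unit_neq0 nu1; have nuc := conj_unit nu1.
have k0 := unit_neq0 k1; have kc := conj_unit k1.
have [lc lE] : exists lc, l^* = lc by exists l^*.
have lcE : lc^* = l by rewrite -lE conjCK.
have lc0 : lc != 0 by rewrite -lE conjC_eq0.
rewrite lE in ll1 lk gE LE.
have ln1 : 1 - l != 0.
  by apply: contraNneq ll1 => /eqP; rewrite subr_eq0 => /eqP E;
    rewrite -lE -E conjC1 mulr1.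
have lcn1 : 1 - lc != 0 by rewrite -conjC_eq0 !conjsE lcE.
have [c cE] : exists c, c = ((1 - l) * (1 - lc)) ^+ 2 * (1 - (l * lc)^-1).
  by eexists.
have c0 : c != 0.
  rewrite cE mulf_neq0 ?expf_neq0 ?mulf_neq0 // subr_eq0 -(inj_eq invr_inj)
    invr1 invrK eq_sym.
  done.
have cc : c^* = c.
  rewrite cE !conjsE lcE lE; field.
  by rewrite l0 lc0.
have [X XD] : exists X, X = 'i * c / (nu * lc) by eexists.
have XE : X^* = - 'i * c * nu / l.
  by rewrite XD !conjsE cc nuc lcE; field; rewrite l0 nu0.
have i0 : 'i != 0 :> R[i] by rewrite -normr_eq0 normCi oner_eq0.
have ic0 : 'i * c != 0 by rewrite mulf_neq0.
have kl : k = mu ^+ 3 * lc / l by rewrite -lk; field.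
(* Each of the next three facts could fail only if k^2 = mu^2: the first two would give k = mu, the
   third k^2 = mu^2 through the determinant relation [lk]. *)
have pa : phase nu (1 - k) != 0.
  apply: contraNneq k2 => /(phase_eq0 nu1).
  rewrite !conjsE kc -/mu => E; have k10 : 1 - k !=
    0 by rewrite subr_eq0 eq_sym.
  suff -> : k = mu by [].
  apply: (mulfI k10); rewrite {1}E; field. 
  done.
have pX : phase nu X != 0.
  apply: contraNneq k2 => /(phase_eq0 nu1); rewrite XE -/mu => E.
  suff -> : k = mu by [].
  have E2 : l = mu ^+ 2 * lc.
    apply: (mulfI ic0); transitivity (l * lc * nu * X).
      by rewrite XD; field; rewrite nu0 lc0.
    by rewrite E /mu; field.
  by apply: (mulfI l0); rewrite lk E2; ring.
have nX : complex.Im ((1 - k) * X^*) != 0.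
  apply: contraNneq k2 => /Im_eq0_conj; rewrite !conjsE kc XE XD => E.
  have k10 : 1 - k != 0 by rewrite subr_eq0 eq_sym.
  have E2 : l = k * mu * lc.
    apply: (mulfI ic0); apply: (mulfI k10).
    transitivity (- (l * k * nu * lc * ((1 - k^-1) * ('i * c / (nu * lc))))).
      by field; rewrite nu0 lc0 k0.
    by rewrite E /mu; field.
  apply/eqP; apply: (mulfI lc0); apply: (mulfI mu0).
  transitivity (k * (k * mu * lc)); first by ring.
  by rewrite -E2 mulrC lk; ring.
have [rho [rho1 rhos]] : exists rho : R, rho != 0 /\
  phase nu (1 - k) * phase nu (- (rho%:C%C * X)) < 0.
  have [s|s] := ltP (phase nu (1 - k) * phase nu X) 0.
    exists (-1); rewrite oppr_eq0 oner_eq0; split=> //.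
    by rewrite rmorphN rmorph1 mulN1r opprK.
  exists 1; rewrite oner_eq0; split=> //.
  rewrite -mulNr -rmorphN phaseZ mulN1r mulrN oppr_lt0 lt_neqAle s eq_sym.
  by rewrite mulf_neq0.
pose A := (1 - l) * (nu^-1 - nu / l).
pose Ac := (1 - lc) * (nu - nu^-1 / lc).
(* With this [x] the value L at [w1] is i nu times a nonzero real number, so its phase is 0. *)
have [x xE] : exists x, x = 'i * rho%:C%C * Ac by eexists.
have xc : x^* = - 'i * rho%:C%C * A by rewrite xE /Ac !conjsE conj_realC nuc
  invrK lcE.
have rC0 : rho%:C%C != 0 :> R[i] by rewrite fmorph_eq0.
(* The coordinates of [wb] solve <wb - g wb, w1> = 0 within the span of [v1] and [v2]. *)
pose w1 := vec x 1 0; pose wb := vec (- (1 - lc^-1) * x^*) (1 - l) 0.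
have Lw1 : h (w1 - g w1) w1 = 'i * rho%:C%C * nu * ((1 - l) * (1 - lc)) * (1 -
  (l * lc)^-1).
  rewrite LE xc conjC1 conjC0 xE /Ac /A; field.
  by rewrite l0 lc0 nu0.
have Lwa : h (v3 - g v3) v3 = 1 - k by rewrite g3 -[X in X - _]scale1r
  -scalerBl hZl h33 mulr1.
have Lwb : h (wb - g wb) wb = - (rho%:C%C * X).
  rewrite LE !conjsE lE lcE xc xE XD cE /Ac /A; field.
  by rewrite l0 lc0 nu0.
have gw : good mu (h (w1 - g w1) w1).
  have llc : 1 - (l * lc)^-1 != 0 by move: c0; rewrite cE;
    apply: contraNneq => ->; rewrite mulr0.
  rewrite /good Lw1; split; first by rewrite !mulf_eq0 !negb_or i0 rC0 nu0 ln1
    lcn1 llc.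
  rewrite !conjsE conj_realC lE lcE nuc /mu; field.
  by rewrite l0 lc0 nu0.
apply: (three_cr_signs dimV ndg nu1 mun1 gi dg gw (wa := v3) (wb := wb)).
- have v3E : v3 = vec 0 0 1 by rewrite /vec !scale0r !add0r scale1r.
  by rewrite g3 hZl v3E h_vec; ring.
- by rewrite gE !h_vec xc conjC1 conjC0; field; rewrite lc0.
- by rewrite Lwa Lwb.
rewrite Lwa Lwb !conjsE conj_realC mulrN mulrCA -mulNr -rmorphN.
by case: (_ * _) nX => a b /=; simpc => /= b0; rewrite oppr_eq0 mulf_neq0.
Qed.

Lemma vecD x y s x' y' s' :
  vec x y s + vec x' y' s' = vec (x + x') (y + y') (s + s').
Proof. by rewrite /vec addrACA (addrACA (x *: v1)) -!scalerDl. Qed.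

Lemma vecZ a x y s : a *: vec x y s = vec (a * x) (a * y) (a * s).
Proof. by rewrite /vec !scalerDr !scalerA. Qed.

(* If [1 / (1 - mu) = 1/2 + iC] and [2 Y = - C - tau], then for [w = vec x 1 iY] one
   has [L = (1 - mu) (2 x + Y^2 - C^2 - 1/4)]. *)
Lemma unipotent_three_cr (mu : R[i]) (tau : R) (g : 'End(V)) :
  `|mu| = 1 -> mu != 1 -> isometry h g -> det_end g = mu ^+ 3 ->
  g v1 = vec mu 0 0 -> g v3 = vec mu 0 mu ->
  g v2 = vec (mu * Complex (- 2^-1) tau) mu (- mu) ->
  three_cr h mu g.
Proof.
move=> mu1 mun1 gi dg g1 g3 g2.
have [C EC] := unit_half_cot mu1 mun1.
have mc := conj_unit mu1; have mu0 := unit_neq0 mu1.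
have gE x y s : g (vec x y s) =
    vec (mu * (x + s + Complex (- 2^-1) tau * y)) (mu * y) (mu * (s - y)).
  by rewrite lvec g1 g2 g3 !vecZ !vecD; congr vec; ring.
pose Y := - (C + tau) / 2.
pose w r := vec (((C ^+ 2 + 4^-1 + r - Y ^+ 2) / 2)%:C%C) 1 (Complex 0 Y).
(* For r = r' the defect is (1 - mu) r, which [good_real] accepts; for r = 1 and r' = -1 it
   vanishes, which is the compatibility of the two vectors. *)
have key r r' : h (g (w r)) (w r') = h (w r) (w r') - (1 - mu) * ((r + r') /
  2)%:C%C.
  rewrite gE !h_vec conj_realC conjC1 conjE; set x := _%:C%C; set x' := _%:C%C.
  transitivity (mu * (x + x' + Complex (Y ^+ 2) 0 - Complex 2^-1 C)).
    transitivity (mu * ((x + Complex 0 Y + Complex (- 2^-1) tau) + x' +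
      (Complex 0 Y - 1) * Complex 0 (- Y))); first by ring.
    congr (mu * _); rewrite /x /x'; simpc; by congr Complex; rewrite /Y; field.
  have Zsum : Complex 2^-1 C + Complex 2^-1 (- C) = 1 by simpc; congr Complex;
    field.
  have XE : x + x' + Complex (Y ^+ 2) 0 =
      Complex 2^-1 C * Complex 2^-1 (- C) + ((r + r') / 2)%:C%C.
    by rewrite /x /x'; simpc; congr Complex; field.
  have E : mu * Complex 2^-1 C = Complex 2^-1 C - 1.
    by rewrite EC; simpc; congr Complex; field.
  have -> : Complex 0 Y * Complex 0 (- Y) = Complex (Y ^+ 2) 0 by simpc.
  rewrite mulr1 mul1r XE; move: E Zsum; move: (Complex 2^-1 C) (Complex 2^-1 (-
    C)) => Z Zc E Zsum.
  have ZcE : Zc = 1 - Z by rewrite -Zsum addrC addKr.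
  transitivity (mu * Z * (Zc - 1) + mu * ((r + r') / 2)%:C%C); first by ring.
  by rewrite E ZcE; ring.
refine (three_cr_good dimV ndg (w1 := w 1) (w2 := w (-1)) mu1 mun1 gi dg _ _ _).
- rewrite hBl key opprB addrC subrK; apply: good_real => //.
  by rewrite (_ : (1 + 1) / 2 = 1) ?oner_eq0 //; field.
- by rewrite key addNr mul0r mulr0 subr0.
- rewrite hBl key opprB addrC subrK; apply: good_real => //.
  by rewrite (_ : (-1 - 1) / 2 = - 1) ?oppr_eq0 ?oner_eq0 //; field.
Qed.

(* The condition on the phases makes the form [phase nu (L w)] indefinite on the
   [w] allowed for the second reflection, once [w1] is taken far along [v3]. *)
Lemma elliptoparabolic_three_cr (nu l k : R[i]) (t : R) (g : 'End(V))
    (mu : R[i] := nu ^+ 2) :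
  `|nu| = 1 -> mu != 1 -> isometry h g -> det_end g = mu ^+ 3 ->
  `|l| = 1 -> `|k| = 1 -> l != 1 -> k != 1 -> t != 0 ->
  phase nu (1 - k) ^+ 2 * (1 - complex.Re l) <
    phase nu (1 - l) ^+ 2 * (1 - complex.Re k) ->
  g v1 = vec l 0 0 -> g v2 = vec (l * Complex 0 t) l 0 -> g v3 = vec 0 0 k ->
  three_cr h mu g.
Proof.
move=> nu1 mun1 gi dg l1 k1 ln1 kn1 t0 ab g1 g2 g3.
have gE x y s : g (vec x y s) = vec (l * (x + Complex 0 t * y)) (l * y) (k * s).
  by rewrite lvec g1 g2 g3 !vecZ !vecD; congr vec; ring.
have nuc := conj_unit nu1; have lc := conj_unit l1; have kc := conj_unit k1.
have [[l0 k0] nu0] := (unit_neq0 l1, unit_neq0 k1, unit_neq0 nu1).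
have Lre := Re_unit_lt1 l1 ln1; have Kre := Re_unit_lt1 k1 kn1.
have l10 : 1 - l != 0 by rewrite subr_eq0 eq_sym.
have k10 : 1 - k != 0 by rewrite subr_eq0 eq_sym.
pose a := phase nu (1 - l); pose b := phase nu (1 - k).
pose e := phase nu (- (l * Complex 0 1)).
pose r := Num.sqrt ((1 - complex.Re k) / (1 - complex.Re l)).
have r_gt0 : 0 < r by rewrite sqrtr_gt0 divr_gt0 // subr_gt0.
have r2 : r ^+ 2 * (1 - complex.Re l) = 1 - complex.Re k.
  by rewrite sqr_sqrtr ?divfK ?gt_eqF ?subr_gt0 // divr_ge0 // ltW ?subr_gt0.
have a0 : a != 0.
  apply: contraTneq ab; rewrite -/a => ->; rewrite expr0n mul0r -leNgt.
  by rewrite mulr_ge0 ?sqr_ge0 // ltW ?subr_gt0.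
have ar : (b - a * r) * (b + a * r) < 0.
  rewrite -subr_sqr subr_lt0 exprMn -(ltr_pM2r (_ : 0 < 1 - complex.Re l))
    ?subr_gt0 //.
  by rewrite -[a ^+ 2 * _ * _]mulrA r2.
have normRe (z : R[i]) : `|z| = 1 -> (1 - z) * (1 - z)^* =
  (2 * (1 - complex.Re z))%:C%C.
  case: z => x y /norm1P /= N; rewrite !conjsE conjE; simpc; congr Complex;
    last by ring.
  transitivity (1 - 2 * x + (x ^+ 2 + y ^+ 2)); first by ring.
  by rewrite N; ring.
(* The value of [r] makes [z] a unit, so the third coordinates of [w1] and [w ep] have equal
   modulus, while (1 - k) z is a real multiple of 1 - l and is absorbed by a real shift of the first
   coordinate. *)
have [z zE] : exists z, z = (1 - l) * r%:C%C / (1 - k) by eexists.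
have zz : z * z^* = 1.
  have -> : z * z^* = (1 - l) * (1 - l)^* * (r ^+ 2)%:C%C / ((1 - k) * (1 -
    k)^*).
    rewrite zE conjM conjV conjM conj_realC rmorphXn /= invfM; ring.
  rewrite !normRe // -rmorphM -fmorphV -rmorphM /= -r2; apply/eqP.
  rewrite (_ : _ / _ = 1) ?rmorph1 //; field.
  by rewrite ?gt_eqF ?subr_gt0 ?r_gt0 ?Lre.
have [M EM] := unit_half_cot l1 ln1.
pose P := complex.Im ((1 - l) * (1 - k)^*);
  pose Q := complex.Im ((1 - l) * (- (l * Complex 0 t))^*).
have Q0 : Q != 0.
  have -> : Q = t * (complex.Re l - 1).
    rewrite /Q; move: l1; case: (l) => x y /norm1P /= N.
    transitivity (t * (x - (x ^+ 2 + y ^+ 2))); first by ring.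
    by rewrite N.
  by rewrite mulf_neq0 // subr_eq0 lt_eqF.
have [c c_gt0 [sgn npar]] := @large_square R (b - a * r) (b + a * r) ((e - a *
  M) * t) P Q ar (introT orP (or_intror Q0)).
(* [x1] makes the phase of L at [w1] zero; [x2 ep] then solves <w ep - g (w ep), w1> = 0, using 1 /
   (1 - l) = 1/2 + iM. *)
pose S := c ^+ 2; pose x1 := - (e * t + b * S) / (2 * a).
pose x2 ep := Complex (- x1 - M * t - ep * r * S) (- t / 2).
pose w1 := vec x1%:C%C 1 c%:C%C.
pose w ep := vec (x2 ep) 1 (ep%:C%C * c%:C%C * z).
have LE x s : h (vec x 1 s - g (vec x 1 s)) (vec x 1 s) =
    (1 - l) * (x + x^*) - l * Complex 0 t + (1 - k) * (s * s^*).
  by rewrite gE vecB h_vec conjC1; ring.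
have Lw1 : h (w1 - g w1) w1 = (1 - l) * (2 * x1)%:C%C - l * Complex 0 t + (1 -
  k) * S%:C%C.
  by rewrite LE !conj_realC /S; ring.
have i_t : Complex 0 t = t%:C%C * Complex 0 1 :> R[i] by simpc.
have Lw ep : ep ^+ 2 = 1 -> h (w ep - g (w ep)) (w ep) =
  (1 - l) * (- 2 * (x1 + M * t + ep * r * S))%:C%C - l * Complex 0 t + (1 - k)
    * S%:C%C.
  move=> ep1; rewrite LE; congr (_ * _ - _ + _ * _).
    by rewrite conjE; simpc; congr Complex; ring.
  rewrite !conjM !conj_realC; transitivity ((ep ^+ 2)%:C%C * S%:C%C * (z *
    z^*)).
    by rewrite /S; ring.
  by rewrite ep1 zz mulr1 rmorph1 mul1r.
have phE X : phase nu ((1 - l) * X%:C%C - l * Complex 0 t + (1 - k) * S%:C%C) =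
  a * X + e * t + b * S.
  have -> : (1 - l) * X%:C%C - l * Complex 0 t + (1 - k) * S%:C%C =
     X%:C%C * (1 - l) + t%:C%C * - (l * Complex 0 1) + S%:C%C * (1 - k).
    by rewrite i_t; ring.
  by rewrite !phaseD !phaseZ -/a -/b -/e; ring.
have W ep : h (g (w ep)) w1 = h (w ep) w1.
  rewrite gE !h_vec conjC1 !conj_realC.
  have x2E : x2 ep = - x1%:C%C + Complex 0 t * (Complex 2^-1 M - 1) - (ep * r *
    S)%:C%C.
    by rewrite /x2; simpc; congr Complex; field.
  have E1 : (1 - l) * Complex 2^-1 M = 1.
    by rewrite mulrBl mul1r EM; simpc; congr Complex; field.
  have E2 : (1 - k) * z = (1 - l) * r%:C%C by rewrite zE mulrC divfK.
  apply/eqP; rewrite eq_sym -subr_eq0 x2E; move: E1;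
    move: (Complex 2^-1 M) => Z E1.
  rewrite (_ : _ - _ = Complex 0 t * ((1 - l) * Z - 1) + ep%:C%C * S%:C%C * ((1
    - k) * z - (1 - l) * r%:C%C)).
    by rewrite E1 E2 !subrr !mulr0 addr0.
  by rewrite /S; ring.
(* The result does not depend on X, since |1 - l|^2 X is real. It yields both L != 0 at [w1] and the
   non-proportionality of the two values of L, which differ by a real multiple of 1 - l. *)
have cr X : complex.Im ((1 - l) * ((1 - l) * X%:C%C - l * Complex 0 t + (1 - k)
  * S%:C%C)^*) = P * S + Q.
  rewrite /P /Q; move: (1 - l) (l * Complex 0 t) (1 - k) =>
    [u1 u2] [p1 p2] [q1 q2].
  by rewrite !conjsE !conj_realC !conjE; simpc => /=; ring.
have a2x1 : a * (2 * x1) = - (e * t + b * S) by rewrite /x1; field.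
refine (three_cr_signs dimV ndg nu1 mun1 gi dg (w1 := w1) (wa := w 1) (wb :=
  w (-1)) _ _ _ _ _).
- rewrite Lw1; apply: phase_good => //.
    by apply: contra_neq npar => E; rewrite -[LHS](cr (2 * x1)) E conjC0 mulr0.
  by rewrite phE a2x1; ring.
- exact: W.
- exact: W.
- rewrite !Lw ?expr1n ?sqrrN ?expr1n // !phE.
  have pE ep : a * (- 2 * (x1 + M * t + ep * r * S)) + e * t + b * S =
      2 * ((b - ep * (a * r)) * S + (e - a * M) * t).
    transitivity (- (a * (2 * x1)) - 2 * a * (M * t + ep * r * S) + e * t + b *
      S); first by ring.
    by rewrite a2x1; ring.
  rewrite !pE mul1r mulN1r opprK.
  move: sgn; rewrite -/S; move: (_ + _) (_ + _) => y y' sgn.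
  by rewrite mulrACA pmulr_rlt0 // mulr_gt0.
rewrite !Lw ?expr1n ?sqrrN ?expr1n //.
have -> : (1 - l) * (- 2 * (x1 + M * t + 1 * r * S))%:C%C - l * Complex 0 t +
  (1 - k) * S%:C%C =
  (1 - l) * (- 4 * r * S)%:C%C + ((1 - l) * (- 2 * (x1 + M * t + -1 * r *
    S))%:C%C - l * Complex 0 t + (1 - k) * S%:C%C).
  ring.
have /= := cr (- 2 * (x1 + M * t + -1 * r * S)).
move: (_ - _ + _) => Y E.
have -> : complex.Im (((1 - l) * (- 4 * r * S)%:C%C + Y) * Y^*) =
  - 4 * r * S * complex.Im ((1 - l) * Y^*).
  by move: (1 - l) Y {E} => [u1 u2] [p1 p2]; rewrite !conjE; simpc => /=; ring.
have S0 : S != 0 by rewrite gt_eqF ?exprn_gt0.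
rewrite E; apply: mulf_neq0; last exact: npar.
apply: mulf_neq0 => //; apply: mulf_neq0; last by rewrite gt_eqF.
by rewrite oppr_eq0 pnatr_eq0.
Qed.

(* Here [1 - g] is not invertible and the three centers have to lie in the
   degenerate plane orthogonal to [v1]. *)
Lemma vertical_three_cr (nu : R[i]) (t : R) (g : 'End(V)) (mu : R[i] :=
  nu ^+ 2) :
  `|nu| = 1 -> isometry h g -> det_end g = mu ^+ 3 -> t != 0 ->
  complex.Re mu < - 2^-1 ->
  g v1 = vec 1 0 0 -> g v2 = vec (Complex 0 t) 1 0 ->
  g v3 = vec 0 0 (mu ^+ 3) -> three_cr h mu g.
Proof.
move=> nu1 gi dg t0 Rmu g1 g2 g3.
have mun1 : mu != 1 by apply/eqP => E; move: Rmu; rewrite E /=; lra.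
have gE x y s : g (vec x y s) = vec (x + Complex 0 t * y) y (mu ^+ 3 * s).
  by rewrite lvec g1 g2 g3 !vecZ !vecD; congr vec; ring.
have nuc := conj_unit nu1; have nu0 := unit_neq0 nu1.
pose n1 := complex.Re nu; pose n2 := complex.Im nu.
have N : n1 ^+ 2 + n2 ^+ 2 = 1 := norm1P nu1.
(* As Re mu = 2 n1^2 - 1, the hypothesis on [mu] means |n1| < 1/2, that is, 2 n1 - 1 and 2 n1 + 1
   have opposite signs. *)
have n14 : 4 * n1 ^+ 2 - 1 < 0.
  have : complex.Re mu = n1 ^+ 2 - n2 ^+ 2.
    by rewrite /mu /n1 /n2; case: (nu) => a b; rewrite expr2; simpc => /=; ring.
  by move=> E; move: Rmu N; rewrite E; lra.
have n20 : n2 != 0 by apply/eqP => E; move: N n14; rewrite E; lra.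
have AB : (4 * n2 * (2 * n1 - 1)) * (4 * n2 * (2 * n1 + 1)) < 0.
  have -> : (4 * n2 * (2 * n1 - 1)) * (4 * n2 * (2 * n1 + 1)) =
    16 * n2 ^+ 2 * (4 * n1 ^+ 2 - 1) by ring.
  by rewrite pmulr_rlt0 // mulr_gt0 // exprn_even_gt0.
have P0 : n2 * (4 * n1 ^+ 2 - 1) != 0 by rewrite mulf_neq0 // lt_eqF.
have [c c_gt0 [sgn npar]] := large_square (- t) (Q :=
  - (n1 * t)) AB (introT orP (or_introl P0)).
pose p := vec c%:C%C 0 1.
(* The factor [nu ^- 3] makes the third coordinates of [w ep] and of its image conjugate, since g
   multiplies by nu^6. *)
pose w (ep : R) := vec 0 1 (ep%:C%C * c%:C%C * nu ^- 3).
have hpp : h p p = 1 by rewrite h_vec conjC0 conjC1; ring.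
have Lw ep : ep ^+ 2 = 1 -> h (w ep - cr h mu^-1 p (g (w ep))) (w ep) =
    nu * Complex (n2 * (4 * n2 * (2 * n1 - ep) * c ^+ 2 - t))
      (c ^+ 2 * n2 * (4 * ep * n1 - 2) - t * n1).
  move=> ep2; rewrite crE hpp divr1 /p gE !h_vec conjC0 conjC1 vecZ vecD vecB
    h_vec.
  rewrite !conjsE !conj_realC nuc.
  have -> : Complex (n2 * (4 * n2 * (2 * n1 - ep) * c ^+ 2 - t))
      (c ^+ 2 * n2 * (4 * ep * n1 - 2) - t * n1) =
    - (Complex 0 t * nu^-1) + (c%:C%C) ^+ 2 * (2 * nu^-1 - nu ^+ 3 - nu^-1 ^+ 3
        + 2 * ep%:C%C * (nu ^+ 2 - 1)).
    have nuE : nu = Complex n1 n2 by rewrite /n1 /n2; case: (nu).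
    have cube (x y : R) : Complex x y ^+ 3 =
        Complex (x ^+ 3 - 3 * x * y ^+ 2) (3 * x ^+ 2 * y - y ^+ 3).
      by rewrite exprS expr2; simpc; congr Complex; ring.
    rewrite -nuc nuE conjE !cube -rmorphXn !expr2; simpc; congr Complex;
      apply/eqP.
      rewrite -subr_eq0; apply/eqP.
      transitivity (c ^+ 2 * (2 * n1 - 2 * ep) * (n1 ^+ 2 + n2 ^+ 2 - 1));
        first by ring.
      by rewrite N subrr mulr0.
    by apply/eqP; ring.
  have E2 : ep%:C%C ^+ 2 = 1 :> R[i] by rewrite -rmorphXn ep2 rmorph1.
  transitivity (nu * (- (Complex 0 t * nu^-1) + (c%:C%C) ^+ 2 * (2 * nu^-1 - nu
    ^+ 3 - nu^-1 ^+ 3 + 2 * ep%:C%C * (nu ^+ 2 - 1))) + (ep%:C%C ^+ 2 - 1) *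
    c%:C%C ^+ 2 * (1 - nu ^+ 4)).
    by rewrite /mu; field.
  by rewrite E2 subrr !mul0r addr0.
have phE ep : ep ^+ 2 = 1 -> phase nu (h (w ep - cr h mu^-1 p (g (w ep))) (w
  ep)) = n2 * (4 * n2 * (2 * n1 - ep) * c ^+ 2 - t).
  move=> ep2; rewrite Lw // /phase mulrA nuc mulVf // mul1r //.
refine (three_cr_reduce_signs dimV ndg nu1 mun1 gi dg (p := p) (u := v1) (wa :=
  w 1) (wb := w (-1)) _ _ _ _ _).
- by rewrite hpp oner_eq0.
- by apply: contra_eqN h12 => /eqP ->; rewrite h0l eq_sym oner_eq0.
- rewrite cr_id; first by rewrite g1 /vec scale1r !scale0r !addr0.
  by rewrite -[v1](_ : vec 1 0 0 = v1) ?h_vec ?conjC0;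
    [ring | rewrite /vec scale1r !scale0r !addr0].
- rewrite !phE ?expr1n ?sqrrN ?expr1n //.
  rewrite opprK.
  by rewrite (mulrACA n2) pmulr_rlt0 // -expr2 exprn_even_gt0.
rewrite !Lw ?expr1n ?sqrrN ?expr1n // !conjsE nuc !conjE.
rewrite mulrACA divff // mul1r; simpc => /=;
  rewrite -[X in X != 0](_ : 16 * (n2 ^+ 2 * c ^+ 2) * (n2 * (4 * n1 ^+ 2 - 1)
  * c ^+ 2 + - (n1 * t)) = _).
  apply: mulf_neq0; last exact: npar.
  apply: mulf_neq0; first by rewrite pnatr_eq0.
  by apply: mulf_neq0; apply: expf_neq0; rewrite // gt_eqF.
ring.
Qed.

(* Again [1 - g] is not invertible; the three centers lie in the plane orthogonal
   to [v3]. *)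
Lemma positive_fixed_three_cr (nu : R[i]) (t : R) (g : 'End(V)) (mu : R[i] :=
  nu ^+ 2) :
  `|nu| = 1 -> mu != 1 -> isometry h g -> det_end g = mu ^+ 3 -> t != 0 ->
  g v1 = vec (nu ^+ 3) 0 0 -> g v2 = vec (nu ^+ 3 * Complex 0 t) (nu ^+ 3) 0 ->
  g v3 = vec 0 0 1 -> three_cr h mu g.
Proof.
move=> nu1 mun1 gi dg t0 g1 g2 g3.
have gE x y s : g (vec x y s) = vec (nu ^+ 3 * (x + Complex 0 t * y)) (nu ^+ 3
  * y) s.
  by rewrite lvec g1 g2 g3 !vecZ !vecD; congr vec; ring.
have nuc := conj_unit nu1; have nu0 := unit_neq0 nu1.
have mu1 : `|mu| = 1 by rewrite normrX nu1 expr1n.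
have Rmu := Re_unit_lt1 mu1 mun1.
pose u := complex.Re mu; pose v := complex.Im mu; pose n1 := complex.Re nu.
have UV : u ^+ 2 + v ^+ 2 = 1 := norm1P mu1.
have n1b : - 1 <= n1 <= 1.
  have := norm1P nu1; rewrite -/n1; have := sqr_ge0 (complex.Im nu).
  by move=> ? ?; apply/andP; split; nra.
pose q := v - complex.Im ((mu - 1) * nu).
(* For small [eta] the positive constant 1 - u dominates the first expression; the sign of [eta] is
   taken so that [eta * q] is nonnegative. The two conditions become the sign change and the
   non-proportionality below. *)
have [eta [eta0 etaP etaQ]] : exists eta : R, [/\ eta != 0,
    0 < 4 * eta ^+ 2 * (u - n1) + 4 * eta * v + (1 - u) & eta * q + (1 - u) !=
      0].
  have u1 : 0 < 1 - u by rewrite subr_gt0.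
  have vb : - 1 <= v <= 1 by have := sqr_ge0 u; move=> ?; apply/andP; split;
    nra.
  have ub : - 1 <= u by have := sqr_ge0 v; move=> ?; nra.
  pose ep := (1 - u) / 16.
  have key eta : `|eta| = ep -> 0 < 4 * eta ^+ 2 * (u - n1) + 4 * eta * v + (1
    - u).
    move=> E; have e2 : eta ^+ 2 = ep ^+ 2 by rewrite -E real_normK ?num_real.
    have ev : - (4 * ep) <= 4 * eta * v.
      rewrite -E -mulrA -mulrN ler_pM2l // lerNl -mulNr.
      rewrite (le_trans (ler_norm _)) // normrM normrN ler_piMr // ler_norml.
      exact: vb.
    have e2u : - (8 * ep ^+ 2) <= 4 * eta ^+ 2 * (u - n1).
      have := sqr_ge0 ep; rewrite e2; case/andP: n1b => _ n1b; nra.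
    have : 8 * ep ^+ 2 <= ep by rewrite /ep; nra.
    by move: ev e2u; rewrite /ep; lra.
  have [q0|q0] := leP 0 q.
    exists ep; split.
    - by rewrite gt_eqF // divr_gt0.
    - by apply: key; rewrite gtr0_norm // divr_gt0.
    - by rewrite gt_eqF // ltr_wpDl // mulr_ge0 // ltW // divr_gt0.
  exists (- ep); split.
  - by rewrite lt_eqF // oppr_lt0 divr_gt0.
  - by apply: key; rewrite normrN gtr0_norm // divr_gt0.
  - by rewrite mulNr -mulrN gt_eqF // ltr_wpDl // mulr_ge0 ?oppr_ge0 // ltW //
      divr_gt0.
have [P PE] : exists P, P = eta * t by eexists.
have P0 : P != 0 by rewrite PE mulf_neq0.
have PC0 : P%:C%C != 0 :> R[i] by rewrite fmorph_eq0.
(* The imaginary part -t/2 makes the first coordinates of [wb] and nu^-3 g wb conjugate; the real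
   part -P/2 makes <wb, p> imaginary. *)
pose p := vec (P / 2)%:C%C 1 0; pose wb :=
  vec (Complex (- P / 2) (- t / 2)) 1 0.
have v1E : v1 = vec 1 0 0 by rewrite /vec scale1r !scale0r !addr0.
have v3E : v3 = vec 0 0 1 by rewrite /vec scale1r !scale0r !add0r.
have hpp : h p p = P%:C%C by rewrite h_vec conj_realC conjC1 conjC0; field.
have La : h (v1 - cr h mu^-1 p (g v1)) v1 = nu * ((mu - 1) * (P^-1)%:C%C).
  rewrite crE hpp v1E gE h_vec /p !vecZ vecD vecB h_vec !conjsE conj_realC /mu.
  have -> : (P^-1)%:C%C = P%:C%C^-1 :> R[i] by rewrite fmorphV.
  by field; rewrite PC0 nu0.
have Lb : h (wb - cr h mu^-1 p (g wb)) wb =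
  nu * (- P%:C%C * nu^-1 + mu * Complex P (- t) - (mu - 1) * (t ^+ 2 / (4 *
  P))%:C%C).
  rewrite crE hpp /wb gE h_vec /p !vecZ vecD vecB h_vec !conjsE conj_realC
    conjE.
  have [T TE] : exists T : R[i], T = Complex 0 t by eexists.
  have half (x y : R) : Complex (x / 2) (y / 2) = Complex x y / 2.
    by rewrite -[2 in RHS](rmorph_nat (real_complex R) 2) -fmorphV /=; simpc.
  have -> : Complex (- P / 2) (- t / 2) = - (P%:C%C + T) / 2.
    by rewrite half TE; simpc.
  have -> : Complex (- P / 2) (- (- t / 2)) = (T - P%:C%C) / 2.
    by rewrite -mulNr opprK half TE; simpc.
  have -> : (P / 2)%:C%C = P%:C%C / 2 :> R[i] by rewrite rmorphM fmorphV
    rmorph_nat.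
  have -> : Complex P (- t) = P%:C%C - T by rewrite TE; simpc.
  have -> : (t ^+ 2 / (4 * P))%:C%C = - T ^+ 2 / (4 * P%:C%C).
    have -> : - T ^+ 2 = t%:C%C ^+ 2 by rewrite TE !expr2; simpc.
    by rewrite fmorph_div rmorphXn (rmorphM _ 4) rmorph_nat.
  by rewrite -TE /mu; field; rewrite PC0 nu0.
refine (three_cr_reduce_signs dimV ndg nu1 mun1 gi dg (p := p) (u := v3) (wa :=
  v1) (wb := wb) _ _ _ _ _).
- by rewrite hpp.
- by apply: contra_eqN h33 => /eqP ->; rewrite h0l eq_sym oner_eq0.
- rewrite cr_id; first by rewrite g3 -v3E.
  by rewrite v3E /p h_vec conjC0; ring.
- rewrite La Lb /phase !mulrA nuc mulVf // !mul1r.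
  have -> : complex.Re ((mu - 1) * (P^-1)%:C%C) = (u - 1) / P.
    by rewrite /u; case: (mu) => a b; simpc.
  have -> : complex.Re (- P%:C%C * nu^-1 + mu * Complex P (- t) - (mu - 1) * (t
    ^+ 2 / (4 * P))%:C%C)
      = - P * n1 + u * P + v * t - (u - 1) * (t ^+ 2 / (4 * P)).
    by rewrite /u /v /n1 -nuc; case: (mu) (nu) => [a b] [c d]; rewrite conjE;
      simpc => /=; ring.
  rewrite -[X in X < 0](_ : (u - 1) * (4 * eta ^+ 2 * (u - n1) + 4 * eta * v +
    (1 - u)) / (2 * eta) ^+ 2 = _).
    by rewrite mulrAC -mulrA nmulr_rlt0 ?subr_lt0 // mulr_gt0 ?invr_gt0 //
      exprn_even_gt0 // mulf_neq0 // pnatr_eq0.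
  by rewrite PE; field; rewrite eta0 t0.
rewrite La Lb conjsE nuc mulrACA divff // mul1r.
rewrite -[X in X != 0](_ : (eta * q + (1 - u)) / eta = _).
  by rewrite mulf_neq0 // invr_neq0.
have -> : 1 - u = u ^+ 2 + v ^+ 2 - u by rewrite UV.
transitivity ((P * q + (u ^+ 2 + v ^+ 2 - u) * t) / P); first by rewrite PE;
  field; rewrite eta0 t0.
rewrite /q /u /v -nuc; move: (t ^+ 2 / _) => r.
by case: (mu) (nu) => [a b] [c d]; rewrite !conjsE !conj_realC !conjE;
  simpc => /=; field.
Qed.
End Frame.

(** * Cube roots of unity *)

Lemma omega_neq1 (R : realType) : omega R != 1.
Proof.
rewrite /omega; apply/eqP => -[_ /eqP]; rewrite gt_eqF // sin_gt0_pi //.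
have := pi_gt0 R => p0; apply/andP; split; lra.
Qed.

Lemma cube_sub1 (R : realType) (w : R[i]) :
  (w - 1) * (w ^+ 2 + w + 1) = w ^+ 3 - 1.
Proof. by ring. Qed.

Lemma omega_root (R : realType) : omega R ^+ 2 + omega R + 1 = 0.
Proof.
have o3 : omega R ^+ 3 = 1.
  set x : R := 2 * pi / 3; have x3 : x + (x + x) = 2 * pi by rewrite /x; field.
  rewrite exprS expr2 /omega -/x; simpc.
  have -> : cos x * cos x - sin x * sin x = cos (x + x) by rewrite cosD.
  have -> : cos x * sin x + sin x * cos x = sin (x + x) by rewrite sinD addrC.
  rewrite -cosD (addrC (cos x * _)) -sinD x3.
  by rewrite mulr_natl cos2pi sin2pi.
have /eqP := cube_sub1 (omega R); rewrite o3 subrr mulf_eq0 subr_eq0.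
by rewrite (negbTE (omega_neq1 R)) => /eqP.
Qed.

Lemma OmegaP (R : realType) (d : R[i]) : Omega d <-> d ^+ 3 = 1.
Proof.
have o0 := omega_root R; have o3 : omega R ^+ 3 = 1.
  by apply/eqP; rewrite -subr_eq0 -cube_sub1 o0 mulr0.
split=> [[->|->|->]|d3]; rewrite ?expr1n //; first by rewrite exprAC o3 expr1n.
have : (d - 1) * ((d - omega R) * (d - omega R ^+ 2)) = 0.
  move: o0 o3; move: (omega R) => w o0 o3.
  rewrite (_ : _ * _ = d ^+ 3 - w ^+ 3 - (w ^+ 2 + w + 1) * (d ^+ 2 - w * d));
    last by ring.
  by rewrite d3 o3 o0 subrr mul0r subr0.
move/eqP; rewrite !mulf_eq0 !subr_eq0.
by case/or3P => /eqP ->; [constructor 1|constructor 2|constructor 3].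
Qed.

Lemma omega_coords (R : realType) :
  exists2 s : R, s ^+ 2 = 3 / 4 & omega R = Complex (- 2^-1) s.
Proof.
have := omega_root R; have := omega_neq1 R; rewrite expr2 /omega.
set x := cos _; set y := sin _.
have y0 : y != 0.
  rewrite gt_eqF // sin_gt0_pi //.
  have := pi_gt0 R => p0; apply/andP; split; lra.
move=> _; simpc => -[E1 E2].
have xE : x = - 2^-1.
  have /eqP : y * (2 * x + 1) = 0 by rewrite -E2; ring.
  by rewrite mulf_eq0 (negbTE y0) /= => /eqP; lra.
by exists y; [move: E1; rewrite xE; lra | rewrite xE].
Qed.

(** There are three cube roots of unity and each predicate excludes at most one. This selects a lift
    avoiding two bad cases. *)
Lemma pigeonhole_cube_root (R : realType) (P Q : R[i] -> bool) :
  (forall d d', d ^+ 3 = 1 -> d' ^+ 3 = 1 -> P d -> P d' -> d = d') ->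
  (forall d d', d ^+ 3 = 1 -> d' ^+ 3 = 1 -> Q d -> Q d' -> d = d') ->
  exists2 d, d ^+ 3 = 1 & ~~ P d && ~~ Q d.
Proof.
move=> Pu Qu; set w := omega R.
have w1 : w != 1 := omega_neq1 R.
have w3 : w ^+ 3 = 1 by apply/OmegaP; constructor 2.
have w23 : (w ^+ 2) ^+ 3 = 1 by apply/OmegaP; constructor 3.
have w0 : w != 0 by apply: contra_eq_neq w3 => ->;
  rewrite expr0n eq_sym oner_eq0.
have w2w : w ^+ 2 != w by rewrite -subr_eq0 -[X in _ - X]mulr1 -mulrBr
  mulf_neq0 // subr_eq0.
have w21 : w ^+ 2 != 1.
  by apply: contra_neq w1 => E; rewrite -w3 exprS E mulr1.
have one3 : 1 ^+ 3 = 1 :> R[i] := expr1n _ _.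
have [H|H1] := boolP (~~ P 1 && ~~ Q 1); first by exists 1.
have [H|H2] := boolP (~~ P w && ~~ Q w); first by exists w.
exists (w ^+ 2) => //; apply/negPn/negP => H3.
have n1 : 1 <> w by apply/eqP; rewrite eq_sym.
have n2 : 1 <> w ^+ 2 by apply/eqP; rewrite eq_sym.
have n3 : w <> w ^+ 2 by apply/eqP; rewrite eq_sym.
have p1 a b := n1 (Pu _ _ one3 w3 a b); have p2 a b := n2 (Pu _ _ one3 w23 a b).
have p3 a b := n3 (Pu _ _ w3 w23 a b); have q1 a b := n1 (Qu _ _ one3 w3 a b).
have q2 a b := n2 (Qu _ _ one3 w23 a b); have q3 a b := n3 (Qu _ _ w3 w23 a b).
move: H1 H2 H3; rewrite !negb_and !negbK => /orP H1 /orP H2 /orP H3.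
by tauto.
Qed.

(** The three products form an equilateral triangle inscribed in the unit circle; all its vertices
    have real part at least -1/2 only for the triangle of the cube roots of 1. *)
Lemma cube_root_Re (R : realType) (th : R[i]) : `|th| = 1 -> th ^+ 3 != 1 ->
  exists2 d, d ^+ 3 = 1 & complex.Re (d * th) < - 2^-1.
Proof.
case: th => x y /norm1P /= N th3; have [s s2 wE] := omega_coords R.
have w3 : omega R ^+ 3 = 1 by apply/OmegaP; constructor 2.
have w23 : (omega R ^+ 2) ^+ 3 = 1 by apply/OmegaP; constructor 3.
have [H1|H1] := ltP x (- 2^-1); first by exists 1; rewrite ?expr1n // mul1r.
have [H2|H2] := ltP (complex.Re (omega R * Complex x y)) (- 2^-1).
  by exists (omega R).
have [H3|H3] := ltP (complex.Re (omega R ^+ 2 * Complex x y)) (- 2^-1).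
  by exists (omega R ^+ 2).
case/negP: th3; move: H2 H3; rewrite wE !exprS expr0 mulr1; simpc => /= H2 H3.
have {}H3 : - 2^-1 <= - 2^-1 * x + s * y by move: H3; nra.
have xy : 0 <= (2 * (- 2^-1 * x - s * y) + 1) * (2 * (- 2^-1 * x + s * y) + 1).
  by apply: mulr_ge0; lra.
have y2 : y ^+ 2 = 1 - x ^+ 2 by rewrite -N; ring.
(* Together with x >= -1/2 this leaves only x = 1 and x = -1/2, both of which give th^3 = 1. *)
have {}xy : 0 <= (1 - x) * (- 2 - 4 * x).
  have E : (2 * (- 2^-1 * x - s * y) + 1) * (2 * (- 2^-1 * x + s * y) + 1) =
    (1 - x) ^+ 2 - 4 * (s ^+ 2) * y ^+ 2 by field.
  by move: xy; rewrite E s2 y2; nra.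
have : (1 - x) * (2 * x + 1) = 0.
  apply/eqP; rewrite eq_le; apply/andP; split; first by lra.
  rewrite mulr_ge0 //; [have := sqr_ge0 y; nra | lra].
move/eqP; rewrite mulf_eq0 => /orP[/eqP x1 | /eqP x2].
  have /eqP : y ^+ 2 = 0 by rewrite y2 (_ : x = 1); [ring | lra].
  rewrite sqrf_eq0 => /eqP ->; rewrite (_ : x = 1); last by lra.
  by apply/eqP; congr Complex; ring.
have xE : x = - 2^-1 by lra.
have y2' : y * y = 3 / 4 by rewrite -expr2 y2 xE; field.
apply/eqP; congr Complex; rewrite xE.
  by transitivity (3 / 2 * (y * y) - 8^-1); [field | rewrite y2'; field].
by transitivity (y * (3 / 4 - y * y)); [field | rewrite y2' subrr mulr0].
Qed.

(** * Hyperbolic frames *)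

Section Signature.
Variables (R : realType) (V : vectType R[i]) (h : hermitian_form R V).
Hypotheses (dimV : \dim {:V} = 3%N) (hsig : signature_ppm h).

Lemma signature_basis : exists e0 e1 e2 : V,
  [/\ forall x, exists a b c, x = a *: e0 + b *: e1 + c *: e2,
      [/\ h e0 e1 = 0, h e0 e2 = 0 & h e1 e2 = 0],
      0 < h e0 e0, 0 < h e1 e1 & h e2 e2 < 0].
Proof.
have [e [eV eo p0 p1 p2]] := hsig; exists e`_0, e`_1, e`_2; split=> //.
  apply: free3_decomp => //.
  have <- : e = [:: e`_0; e`_1; e`_2] :> seq V.
    by case: (e) => -[|a [|b [|c [|d s]]]].
  exact: basis_free eV.
pose o k (lk : (k < 3)%N) := Ordinal lk.
by split; [apply: (eo (o 0 isT) (o 1 isT)) | apply: (eo (o 0 isT) (o 2 isT))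
  | apply: (eo (o 1 isT) (o 2 isT))].
Qed.

Lemma signature_nondegenerate x : (forall y, h x y = 0) -> x = 0.
Proof.
have [e0 [e1 [e2 [dec [h01 h02 h12] p0 p1 p2]]]] := signature_basis.
have [a [b [c ->]]] := dec x => H.
have [h10 h20 h21] : [/\ h e1 e0 = 0, h e2 e0 = 0 & h e2 e1 = 0].
  by split; rewrite hC (h01, h02, h12) conjC0.
have := H e0; have := H e1; have := H e2.
rewrite !(hDl, hZl) h01 h02 h12 h10 h20 h21 !mulr0 !add0r !addr0.
move=> /eqP; rewrite mulf_eq0 (lt_eqF p2) orbF => /eqP ->.
move=> /eqP; rewrite mulf_eq0 (gt_eqF p1) orbF => /eqP ->.
move=> /eqP; rewrite mulf_eq0 (gt_eqF p0) orbF => /eqP ->.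
by rewrite !scale0r !addr0.
Qed.

(** Subtracting from [y] the multiple of [x] that kills the negative coordinate leaves a vector that
    is still nonpositive, by orthogonality, but lies in a positive definite plane, so it is zero. *)
Lemma nonpositive_orthogonal_colinear x y :
  x != 0 -> h x x <= 0 -> h y y <= 0 -> h x y = 0 -> exists k, y = k *: x.
Proof.
have [e0 [e1 [e2 [dec [h01 h02 h12] p0 p1 p2]]]] := signature_basis.
have h10 : h e1 e0 = 0 by rewrite hC h01 conjC0.
have pos a b : h (a *: e0 + b *: e1) (a *: e0 + b *: e1) <= 0 ->
  a *: e0 + b *: e1 = 0.
  rewrite !(hDl, hDr, hZl, hZr) h01 h10 !mulr0 addr0 add0r !mulrA.
  have A : 0 <= a * a^* * h e0 e0 by rewrite mulr_ge0 ?mul_conjC_ge0 // ltW.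
  have B : 0 <= b * b^* * h e1 e1 by rewrite mulr_ge0 ?mul_conjC_ge0 // ltW.
  move=> C; have : a * a^* * h e0 e0 + b * b^* * h e1 e1 == 0.
    by rewrite eq_le C addr_ge0.
  rewrite paddr_eq0 // !mulf_eq0 !conjC_eq0 !orbb (gt_eqF p0) (gt_eqF p1) !orbF.
  by move=> /andP[/eqP -> /eqP ->]; rewrite !scale0r addr0.
have [a [b [c ->]]] := dec x; have [a' [b' [c' ->]]] := dec y.
have [-> |c0] := eqVneq c 0.
  by rewrite scale0r addr0 => x0 /pos xE; rewrite xE eqxx in x0.
set X := _ + c *: _; set Y := _ + c' *: _ => X0 hX hY XY.
exists (c' / c); apply/eqP; rewrite -subr_eq0; apply/eqP.
have E : Y - (c' / c) *: X = (a' - c' / c * a) *: e0 + (b' - c' / c * b) *: e1.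
  rewrite /X /Y !scalerDr !scalerA divfK // !opprD addrACA subrr addr0 addrACA.
  by rewrite !scalerBl.
have YX : h Y X = 0 by rewrite hC XY conjC0.
rewrite E; apply: pos; rewrite -E !(hBl, hBr, hZl,
  hZr) XY YX !mulr0 !subr0 add0r.
rewrite opprK mulrA -[0](addr0 0) lerD //.
by rewrite mulr_ge0_le0 // mul_conjC_ge0.
Qed.

(** A nonzero [w] orthogonal to [v1] and [v2] is orthogonal to the negative vector v1 - v2. Were it
    nonpositive, it would be a multiple of v1 - v2, which is not orthogonal to [v1]; so it is
    positive and can be normalized. *)
Lemma complete_hyperbolic v1 v2 : h v1 v1 = 0 -> h v2 v2 = 0 -> h v1 v2 = 1 ->
  exists v3, [/\ h v3 v3 = 1, h v1 v3 = 0 & h v2 v3 = 0].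
Proof.
move=> h11 h22 h12; have h21 : h v2 v1 = 1 by rewrite hC h12 conjC1.
have v10 : v1 != 0 by apply: contra_eq_neq h12 => ->;
  rewrite h0l eq_sym oner_eq0.
have fv : free [:: v2; v1].
  apply: free2P => // k E; move: h12; rewrite E hZr h11 mulr0 => /eqP.
  by rewrite eq_sym oner_eq0.
have [x fx] := free_extend dimV fv isT.
pose w := x - h x v2 *: v1 - h x v1 *: v2.
have w0 : w != 0.
  apply/eqP => E; have [] := free3_eq0 (a := 1) (b := - h x v1) (c :=
    - h x v2) fx.
    by rewrite -[RHS]E /w scale1r !scaleNr addrAC.
  by move/eqP; rewrite oner_eq0.
have w1 : h w v1 = 0 by rewrite /w !hBl !hZl h11 h21 mulr0 mulr1 subr0 subrr.
have w2 : h w v2 = 0 by rewrite /w !hBl !hZl h22 h12 mulr0 mulr1 subr0 subrr.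
have n_neg : h (v1 - v2) (v1 - v2) <= 0.
  rewrite !(hBl, hBr) h11 h22 h12 h21 sub0r subr0 -opprD oppr_le0.
  by rewrite addr_ge0 ?ler01.
have ww : 0 < h w w.
  rewrite real_ltNge ?real0 ?CrealE -?hC //; apply/negP => w_neg.
  have n0 : v1 - v2 != 0.
    by rewrite subr_eq0; apply: contra_eq_neq h11 => E;
      rewrite {2}E h12 oner_eq0.
  have nw : h (v1 - v2) w = 0 by rewrite hBl (hC h v1 w) (hC h v2 w) w1 w2
    conjC0 subrr.
  have [k wk] := nonpositive_orthogonal_colinear n0 n_neg w_neg nw.
  move: w1; rewrite wk hZl hBl h11 h21 sub0r mulrN1 => /eqP.
  by rewrite oppr_eq0 => /eqP k0; rewrite wk k0 scale0r eqxx in w0.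
have s0 : sqrtC (h w w) != 0 by rewrite sqrtC_eq0 gt_eqF.
exists ((sqrtC (h w w))^-1 *: w); split.
- rewrite hZl hZr conjV conj_Creal; first by rewrite -{3}(sqrtCK (h w w));
    field.
  by rewrite ger0_real // sqrtC_ge0 ltW.
- by rewrite hZr (hC h v1 w) w1 conjC0 mulr0.
- by rewrite hZr (hC h v2 w) w2 conjC0 mulr0.
Qed.

Lemma hyperbolic_partner v1 : v1 != 0 -> h v1 v1 = 0 ->
  exists2 v2, h v2 v2 = 0 & h v1 v2 = 1.
Proof.
move=> v10 h11; have [y y0] : exists y, h v1 y != 0.
  apply: contrapT => H; move/eqP: v10; apply;
    apply: signature_nondegenerate => y.
  by apply/eqP/negP => /negP yn; apply: H; exists y.
have [u hu] : exists u, h v1 u = 1.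
  by exists ((h v1 y)^*^-1 *: y); rewrite hZr conjV conjCK mulVf.
have hu' : h u v1 = 1 by rewrite hC hu conjC1.
exists (u - (h u u / 2) *: v1).
  rewrite !(hBl, hBr, hZl, hZr) h11 hu hu' conjM conjV -hC conjC_nat.
  by field.
by rewrite hBr hZr h11 mulr0 subr0.
Qed.

End Signature.

(** * Normal forms of loxodromic and parabolic isometries *)

Lemma mul_conj_eq1 (R : realType) (a : R[i]) : (a * a^* == 1) = (`|a| == 1).
Proof. by rewrite -normCK sqrp_eq1. Qed.

Section NormalForm.
Variables (R : realType) (V : vectType R[i]) (h : hermitian_form R V).
Hypotheses (dimV : \dim {:V} = 3%N) (hsig : signature_ppm h).

Definition hyperbolic_frame v1 v2 v3 :=
  [/\ h v1 v1 = 0, h v2 v2 = 0 & h v3 v3 = 1] /\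
  [/\ h v1 v2 = 1, h v1 v3 = 0 & h v2 v3 = 0].

Lemma frame_free v1 v2 v3 : hyperbolic_frame v1 v2 v3 -> free [:: v1; v2; v3].
Proof.
move=> [[h11 h22 h33] [h12 h13 h23]].
have h21 : h v2 v1 = 1 by rewrite hC h12 conjC1.
have h31 : h v3 v1 = 0 by rewrite hC h13 conjC0.
have h32 : h v3 v2 = 0 by rewrite hC h23 conjC0.
apply: free3P => a b c E; split.
- have := congr1 (h^~ v2) E; rewrite /= !(hDl, hZl) h0l h12 h22 h32.
  by rewrite !mulr0 mulr1 !addr0.
- have := congr1 (h^~ v1) E; rewrite /= !(hDl, hZl) h0l h11 h21 h31.
  by rewrite !mulr0 mulr1 !addr0 add0r.
- have := congr1 (h^~ v3) E; rewrite /= !(hDl, hZl) h0l h13 h23 h33.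
  by rewrite !mulr0 mulr1 !add0r.
Qed.

Lemma frame_decomp v1 v2 v3 u : hyperbolic_frame v1 v2 v3 ->
  u = vec v1 v2 v3 (h u v2) (h u v1) (h u v3).
Proof.
move=> fr; have [a [b [c ->]]] := free3_decomp dimV (frame_free fr) u.
have [[h11 h22 h33] [h12 h13 h23]] := fr.
have h21 : h v2 v1 = 1 by rewrite hC h12 conjC1.
have h31 : h v3 v1 = 0 by rewrite hC h13 conjC0.
have h32 : h v3 v2 = 0 by rewrite hC h23 conjC0.
rewrite !(hDl, hZl) h11 h12 h13 h21 h22 h23 h31 h32 h33 !mulr0 !mulr1.
by rewrite !addr0 !add0r.
Qed.

Lemma isometry_eigen_neq0 F v l : isometry h F -> v != 0 -> F v = l *: v ->
  l != 0.
Proof.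
move=> Fi v0 Fv; apply: contra_neq v0 => l0.
apply: (signature_nondegenerate dimV hsig) => y.
by rewrite -Fi Fv l0 scale0r h0l.
Qed.

(** An eigenvector determines one coordinate of every image; with [frame_decomp] this gives the
    zeros and diagonal entries of the normal forms. *)
Lemma isometry_eigen F v l u : isometry h F -> v != 0 -> F v = l *: v ->
  h (F u) v = (l^*)^-1 * h u v.
Proof.
move=> Fi v0 Fv; have l0 := isometry_eigen_neq0 Fi v0 Fv.
by rewrite -(Fi u v) Fv hZr mulKf // conjC_eq0.
Qed.

Lemma loxodromic_normal_form F v1 v2 l m : isometry h F ->
  h v1 v1 = 0 -> h v2 v2 = 0 -> h v1 v2 = 1 ->
  F v1 = l *: v1 -> F v2 = m *: v2 ->
  (forall v a, h v v < 0 -> F v <> a *: v) ->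
  exists v3 k, [/\ hyperbolic_frame v1 v2 v3, l != 0, l * l^* != 1, `|k| = 1 &
    F v2 = l^*^-1 *: v2 /\ F v3 = k *: v3].
Proof.
move=> Fi h11 h22 h12 F1 F2 Fneg; have h21 : h v2 v1 =
  1 by rewrite hC h12 conjC1.
have v10 : v1 != 0 by apply: contra_eq_neq h12 => ->;
  rewrite h0l eq_sym oner_eq0.
have v20 : v2 != 0 by apply: contra_eq_neq h12 => ->;
  rewrite h0r eq_sym oner_eq0.
have l0 := isometry_eigen_neq0 Fi v10 F1.
have mE : m = l^*^-1.
  by have := isometry_eigen v2 Fi v10 F1; rewrite F2 hZl h21 !mulr1.
have [v3 [h33 h13 h23]] := complete_hyperbolic dimV hsig h11 h22 h12.
have fr : hyperbolic_frame v1 v2 v3 by [].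
have h31 : h v3 v1 = 0 by rewrite hC h13 conjC0.
have h32 : h v3 v2 = 0 by rewrite hC h23 conjC0.
have [k F3] : exists k, F v3 = k *: v3.
  exists (h (F v3) v3); rewrite {1}(frame_decomp (F v3) fr) (isometry_eigen _
    Fi v10 F1).
  by rewrite (isometry_eigen _ Fi v20 F2) h31 h32 !mulr0 /vec !scale0r !add0r.
exists v3, k; split=> //; last by rewrite -mE.
  (* If |l| = 1, both isotropic eigenvalues agree and v1 - v2 is a negative eigenvector. *)
  apply/eqP => ll1; have ml : m = l.
    by rewrite mE -[RHS](mulfK (_ : l^* != 0)) ?conjC_eq0 // ll1 mul1r.
  apply: (Fneg (v1 - v2) l); last by rewrite linearB /= F1 F2 ml scalerBr.
  rewrite !(hBl, hBr) h11 h22 h12 h21 sub0r subr0 -opprD oppr_lt0.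
  by rewrite addr_gt0 ?ltr01.
by apply/eqP; rewrite -mul_conj_eq1 -[X in _ ==
  X]h33 -(Fi v3 v3) F3 hZl hZr h33 mulr1.
Qed.

(* The two alternatives are the ellipto-parabolic isometries and, up to a scalar,
   the unipotent ones. *)
Lemma parabolic_normal_form F v1 l : isometry h F ->
  v1 != 0 -> h v1 v1 = 0 -> F v1 = l *: v1 ->
  (forall v a, h v v < 0 -> F v <> a *: v) ->
  (forall v a, v != 0 -> h v v = 0 -> F v = a *: v -> exists c, v = c *: v1) ->
  (forall v, F v = l *: v -> exists c, v = c *: v1) ->
  `|l| = 1 /\ exists w1 w2 w3, hyperbolic_frame w1 w2 w3 /\
   ((exists k t, [/\ `|k| = 1, k <> l & t != 0] /\
    [/\ F w1 = vec w1 w2 w3 l 0 0, F w2 = vec w1 w2 w3 (l * Complex 0 t) l 0 &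
        F w3 = vec w1 w2 w3 0 0 k]) \/
   (exists tau, [/\ F w1 = vec w1 w2 w3 l 0 0,
        F w2 = vec w1 w2 w3 (l * Complex (- 2^-1) tau) l (- l) &
        F w3 = vec w1 w2 w3 l 0 l])).
Proof.
move=> Fi v10 h11 F1 Fneg Funiq Freg; have l0 := isometry_eigen_neq0 Fi v10 F1.
have [v2 h22 h12] := hyperbolic_partner dimV hsig v10 h11.
have [v3 [h33 h13 h23]] := complete_hyperbolic dimV hsig h11 h22 h12.
have fr : hyperbolic_frame v1 v2 v3 by [].
have h21 : h v2 v1 = 1 by rewrite hC h12 conjC1.
have h31 : h v3 v1 = 0 by rewrite hC h13 conjC0.
have h32 : h v3 v2 = 0 by rewrite hC h23 conjC0.
have [k [a F3]] : exists k a, F v3 = vec v1 v2 v3 a 0 k.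
  exists (h (F v3) v3), (h (F v3) v2).
  by rewrite {1}(frame_decomp (F v3) fr) (isometry_eigen _ Fi v10 F1) h31 mulr0.
have k1 : `|k| = 1.
  apply/eqP; rewrite -mul_conj_eq1 -[X in _ == X]h33 -(Fi v3 v3) F3.
  by rewrite (h_vec h11 h22 h33 h12 h13 h23) conjC0 mulr0 mul0r !add0r.
have vecZ1 (w1 w2 w3 : V) x : vec w1 w2 w3 x 0 0 = x *: w1.
  by rewrite /vec !scale0r !addr0.
have [kl|kl] := eqVneq k l; last first.
  have kl0 : k - l != 0 by rewrite subr_eq0.
  (* [c] corrects [v3] to an eigenvector [w3]; the coordinates of [w2] restore the frame
     relations. *)
  have [c cE] : exists c, c = a / (k - l) by eexists.
  pose w3 := vec v1 v2 v3 c 0 1.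
  pose w2 := vec v1 v2 v3 (- (c * c^* / 2)) 1 (- c^*).
  have v1E : v1 = vec v1 v2 v3 1 0 0 by rewrite vecZ1 scale1r.
  have hvE := h_vec h11 h22 h33 h12 h13 h23.
  have fr' : hyperbolic_frame v1 w2 w3.
    split; split.
    - exact: h11.
    - by rewrite hvE !conjsE; field.
    - by rewrite hvE conjC0 conjC1; ring.
    - by rewrite {1}v1E hvE conjC1; ring.
    - by rewrite {1}v1E hvE conjC0 conjC1; ring.
    - by rewrite hvE conjC0 conjC1; ring.
  have Fw3 : F w3 = k *: w3.
    rewrite lvec F1 F3 scale0r addr0 scale1r -{1}(vecZ1 v1 v2 v3) !vecZ vecD.
    by rewrite cE; congr vec; field.
  have w30 : w3 != 0.
    apply/eqP => E; case: fr' => -[_ _] /eqP; rewrite E h0l eq_sym oner_eq0 //.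
  have [b Fw2] : exists b, F w2 = vec v1 w2 w3 b (l^*^-1) 0.
    exists (h (F w2) w2); rewrite {1}(frame_decomp (F w2) fr').
    have [[_ _ _] [h12' _ h23']] := fr'.
    rewrite (isometry_eigen _ Fi v10 F1) (isometry_eigen _ Fi w30 Fw3) h23'
      mulr0.
    by rewrite (hC h w2 v1) h12' conjC1 mulr1.
  clearbody w2 w3.
  have [[_ h22' h33'] [h12' h13' h23']] := fr'.
  have h21' : h w2 v1 = 1 by rewrite hC h12' conjC1.
  have hvE' := h_vec h11 h22' h33' h12' h13' h23'.
  (* Otherwise the eigenvalue [l^*^-1] differs from [l] and has an isotropic eigenvector outside the
     line of [v1], against [Funiq]. *)
  have l1 : `|l| = 1.
    apply/eqP; rewrite -mul_conj_eq1; apply/negPn/negP => ll1.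
    have lc0 : l^* != 0 by rewrite conjC_eq0.
    have [m mE] : exists m, m = l^*^-1 by eexists.
    have ml : m - l != 0.
      rewrite subr_eq0; apply: contra_neq ll1 => E.
      by rewrite -{1}E mE mulVf.
    pose w := vec v1 w2 w3 (b / (m - l)) 1 0.
    have Fw : F w = m *: w.
      rewrite lvec F1 Fw2 -mE scale0r addr0 scale1r -{1}(vecZ1 v1 w2 w3) !vecZ
        vecD.
      by congr vec; field.
    have hw1 : h v1 w = 1.
      have v1E' : v1 = vec v1 w2 w3 1 0 0 by rewrite vecZ1 scale1r.
      by rewrite {1}v1E' hvE' !conjsE; ring.
    have w0 : w != 0.
      by apply: contra_eq_neq hw1 => ->; rewrite h0r eq_sym oner_eq0.
    have hww : h w w = 0.
      apply/eqP; have := Fi w w; rewrite Fw hZl hZr mulrA => /eqP.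
      rewrite -subr_eq0 -[X in _ - X]mul1r -mulrBl mulf_eq0 subr_eq0 =>
        /orP[|//].
      move=> mm; case/negP: ll1; rewrite -(inj_eq invr_inj) invr1 invfM mulrC.
      by move: mm; rewrite mE conjV conjCK.
    have [d wd] := Funiq w m w0 hww Fw.
    by move: hw1; rewrite wd hZr h11 mulr0 => /eqP; rewrite eq_sym oner_eq0.
  split=> //; exists v1, w2, w3; split=> //; left.
  have lc := conj_unit l1.
  have bl : b / l + (b / l)^* = 0.
    have := Fi w2 w2; rewrite Fw2 hvE' h22' lc invrK !conjsE lc invrK mul0r
      addr0.
    by rewrite (mulrC b^*).
  have [t bt] : exists t, b / l = Complex 0 t.
    by move: bl; case: (b / l) => x y; rewrite conjE; simpc => -[x0]; exists y;
      congr Complex; lra.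
  have bE : b = l * Complex 0 t by rewrite -bt mulrC divfK.
  exists k, t; split; last first.
    by split; [rewrite vecZ1 | rewrite Fw2 bE lc invrK | rewrite Fw3 /vec
      !scale0r !add0r].
  split=> //; first exact/eqP.
  apply/eqP => t0; apply: (Fneg (v1 - w2) l).
    rewrite !(hBl, hBr) h11 h22' h12' h21' sub0r subr0 -opprD oppr_lt0.
    by rewrite addr_gt0 ?ltr01.
  rewrite linearB /= F1 Fw2 bE t0 lc invrK mulr0 /vec !scale0r add0r addr0.
  by rewrite scalerBr.
rewrite kl in k1 F3; split=> //; have lc := conj_unit k1.
(* Here regularity enters: if [a] were 0, [v3] would be a second eigenvector for [l]. *)
have a0 : a != 0.
  apply/eqP => az; have [|d v3d] := Freg v3.
    by rewrite F3 az /vec !scale0r !add0r.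
  by move/eqP: h33; rewrite v3d hZl hZr h11 !mulr0 eq_sym oner_eq0.
have [r rE] : exists r, r = a / l by eexists.
have r0 : r != 0 by rewrite rE mulf_neq0 ?invr_neq0.
have rc0 : r^* != 0 by rewrite conjC_eq0.
(* The rescaling turns the coefficient of [w1] in [F v3] into [l]. *)
pose w1 := r *: v1; pose w2 := r^*^-1 *: v2.
have fr' : hyperbolic_frame w1 w2 v3.
  by split; split; rewrite /w1 /w2 ?hZl ?hZr ?conjV ?conjCK ?h11 ?h22 ?h12 ?h13
    ?h23 ?mulr0 // mulr1 mulfV.
have w10 : w1 != 0 by rewrite scaler_eq0 negb_or r0.
have Fw1 : F w1 = l *: w1 by rewrite linearZ /= F1 !scalerA mulrC.
have Fw3 : F v3 = vec w1 w2 v3 l 0 l.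
  by rewrite F3 /vec /w1 scalerA rE mulrC divfK // !scale0r.
have [[h11' h22' _] [h12' h13' h23']] := fr'.
have hvE' := h_vec h11' h22' h33 h12' h13' h23'.
have [y [x Fw2]] : exists y x, F w2 = vec w1 w2 v3 y l x.
  exists (h (F w2) w2), (h (F w2) v3); rewrite {1}(frame_decomp (F w2) fr').
  by rewrite (isometry_eigen _ Fi w10 Fw1) (hC h w2 w1) h12' conjC1 mulr1 lc
    invrK.
clearbody w1 w2.
have xE : x = - l.
  have := Fi w2 v3; rewrite Fw2 Fw3 hvE' h23' conjC0 mulr0 add0r -mulrDl =>
    /eqP.
  by rewrite mulf_eq0 conjC_eq0 (negbTE l0) orbF addrC addr_eq0 => /eqP.
have yl : y / l + (y / l)^* = - 1.
  have := Fi w2 w2; rewrite Fw2 hvE' h22' xE !conjsE lc => E.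
  apply/eqP; rewrite -subr_eq0 -[0]E; apply/eqP; rewrite invrK.
  by field.
exists w1, w2, v3; split=> //; right.
have [t yt] : exists t, y / l = Complex (- 2^-1) t.
  move: yl; case: (y / l) => p q; rewrite conjE; simpc => -[pE].
  by exists q; congr Complex; lra.
exists t; split=> //; first by rewrite vecZ1.
by rewrite Fw2 xE -yt (mulrC l) divfK.
Qed.
End NormalForm.

(** * The decomposition *)

Section Projective.
Variables (R : realType) (V : vectType R[i]) (h : hermitian_form R V).

Lemma rep_neq0 (p : PV V) : rep p != 0.
Proof. by rewrite /rep vpick0 -dimv_eq0 (eqP (valP p)). Qed.

Lemma line_rep (p : PV V) : val p = <[rep p]>%VS.
Proof.
apply/eqP; rewrite eq_sym eqEdim (eqP (valP p)) dim_vline rep_neq0 leqnn andbT.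
by rewrite -memvE memv_pick.
Qed.

Lemma exists_line (v : V) : v != 0 ->
  exists2 p : PV V, val p = <[v]>%VS & exists2 k, k != 0 & rep p = k *: v.
Proof.
move=> v0; have dv : \dim <[v]>%VS == 1%N by rewrite dim_vline v0.
pose p : PV V := exist _ <[v]>%VS dv.
exists p => //; have : rep p \in <[v]>%VS by apply: memv_pick.
case/vlineP => k pk; exists k => //; apply/eqP => k0.
by have := rep_neq0 p; rewrite pk k0 scale0r eqxx.
Qed.

Lemma fixes_coset (F : 'End(V)) (p : PV V) :
  fixes (Omega_coset F) p -> exists l, F (rep p) = l *: rep p.
Proof.
move=> [_ [d /OmegaP d3 <-] dFp].
have d0 : d != 0 by apply: contra_eq_neq d3 => ->;
  rewrite expr0n eq_sym oner_eq0.
have : (d *: F) (rep p) \in val p by rewrite -dFp memv_img // memv_pick.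
rewrite line_rep scale_lfunE => /vlineP[k E]; exists (d^-1 * k).
by rewrite -scalerA -E scalerA mulVf // scale1r.
Qed.

Lemma coset_fixes (F : 'End(V)) (p : PV V) v l : val p = <[v]>%VS -> l != 0 ->
  F v = l *: v -> fixes (Omega_coset F) p.
Proof.
move=> pv l0 Fv; exists F; first by exists 1; [apply/OmegaP;
  rewrite expr1n | rewrite scale1r].
rewrite pv limg_line Fv; apply/eqP; rewrite eqEsubv -!memvE.
rewrite memvZ ?memv_line //=; apply/vlineP; exists l^-1.
by rewrite scalerA mulVf // scale1r.
Qed.

Lemma reflE alpha (p : PV V) v k : alpha != 0 -> k != 0 -> rep p = k *: v ->
  refl h alpha p = alpha *: cr h (alpha ^- 3) v.
Proof.
move=> a0 k0 pk; apply/lfunP => x; rewrite scale_lfunE crE lfunE /=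
  /refl_fun pk.
rewrite !(hZl, hZr) scalerDr scalerA addrC; congr (_ + _); rewrite !scalerA.
congr (_ *: _); have kc0 : k^* != 0 by rewrite conjC_eq0.
(* For isotropic [v] the division by zero annihilates the reflection term on both sides. *)
have [->|vv] := eqVneq (h v v) 0; first by rewrite !mulr0 !invr0 !mulr0 mul0r.
by field; rewrite a0 k0 kc0 vv.
Qed.

(** Each [refl] is alpha times a [cr], so three of them contribute alpha^3, which cancels
    [alpha ^- 3] and leaves the lift [d *: F]. *)
Lemma three_cr_admits (alpha d : R[i]) (F : 'End(V)) : alpha != 0 -> d ^+ 3 =
  1 ->
  three_cr h (alpha ^- 3) ((d * alpha ^- 3) *: F) ->
  admits_alpha3_decomposition h alpha (Omega_coset F).
Proof.
move=> a0 d3 [p [q [r [p0 q0 r0 E]]]].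
have nz v : h v v != 0 -> v != 0 by apply: contraNneq => ->; rewrite h0l.
have rep_iso (P : PV V) v k : k != 0 -> rep P = k *: v -> h v v != 0 ->
  ~ isotropic h P.
  by move=> k0 Pk v0; rewrite /isotropic Pk hZl hZr; apply/eqP;
    rewrite !mulf_neq0 // conjC_eq0.
have [P _ [kp kp0 Pp]] := exists_line (nz _ p0).
have [Q _ [kq kq0 Qq]] := exists_line (nz _ q0).
have [S _ [ks ks0 Sr]] := exists_line (nz _ r0).
exists (d *: F); first by exists d => //; apply/OmegaP.
exists S, Q, P; split; [exact: rep_iso Sr r0|exact: rep_iso Qq q0|exact:
  rep_iso Pp p0|].
rewrite (reflE a0 kp0 Pp) (reflE a0 kq0 Qq) (reflE a0 ks0 Sr).
rewrite -!(comp_lfunZl, comp_lfunZr) !scalerA -E scalerA; congr (_ *: _).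
by field.
Qed.

End Projective.

(** * Choice of the lift and conclusion *)

Section Main.
Variables (R : realType) (V : vectType R[i]) (h : hermitian_form R V).
Hypotheses (dimV : \dim {:V} = 3%N) (hsig : signature_ppm h).
Let ndg := signature_nondegenerate dimV hsig.

Lemma not_elliptic_eigen F : isometry h F ->
  nonidentical (Omega_coset F) -> ~ elliptic h (Omega_coset F) ->
  forall v a, h v v < 0 -> F v <> a *: v.
Proof.
move=> Fi nid nell v a hv Fv; apply: nell; split=> //.
have v0 : v != 0 by apply: contraTneq hv => ->; rewrite h0l ltxx.
have [p pv [k k0 pk]] := exists_line v0; exists p; split.
  by rewrite /negative pk hZl hZr mulrA pmulr_rlt0 // mul_conjC_gt0.
exact: coset_fixes pv (isometry_eigen_neq0 dimV hsig Fi v0 Fv) Fv.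
Qed.

Lemma scaled_isometry (c : R[i]) F : `|c| = 1 -> isometry h F ->
  isometry h (c *: F).
Proof.
move=> c1 Fi x y; rewrite !scale_lfunE hZl hZr Fi mulrA (conj_unit c1) divff
  ?mul1r //.
exact: unit_neq0.
Qed.

Lemma cube_root_norm (d : R[i]) : d ^+ 3 = 1 -> `|d| = 1.
Proof.
move=> d3; apply/eqP; rewrite -(@pexpr_eq1 _ _ 3) // -normrX d3 normr1 //.
Qed.

Lemma sqrt_unit (mu : R[i]) : `|mu| = 1 -> exists2 nu, `|nu| = 1 & mu = nu ^+ 2.
Proof.
move=> mu1; exists (sqrtC mu); last by rewrite sqrtCK.
by apply/eqP; rewrite -sqrp_eq1 // -normrX sqrtCK mu1.
Qed.

Lemma loxodromic_decomposition (alpha : R[i]) F : `|alpha| = 1 -> alpha ^- 3 !=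
  1 ->
  isometry h F -> det_end F = 1 -> loxodromic h (Omega_coset F) ->
  admits_alpha3_decomposition h alpha (Omega_coset F).
Proof.
move=> al1 mun1 Fi dF [nid [p [q [pq fixE]]] nell].
have a0 := unit_neq0 al1; have Fneg := not_elliptic_eigen Fi nid nell.
have [hp fp] : fixed_isotropic h (Omega_coset F) p by rewrite fixE; left.
have [hq fq] : fixed_isotropic h (Omega_coset F) q by rewrite fixE; right.
have [l F1] := fixes_coset fp; have [m F2] := fixes_coset fq.
(* Orthogonal isotropic points would coincide; this allows rescaling to <v1, v2> = 1. *)
have hpq : h (rep p) (rep q) != 0.
  apply/eqP => hpq; have [||k qk] := nonpositive_orthogonal_colinear dimV hsig
    (rep_neq0 p) _ _ hpq.
  - by rewrite hp.
  - by rewrite hq.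
  apply: pq; apply: val_inj => /=; rewrite !line_rep qk; apply/eqP.
  have k0 : k != 0 by apply: contraTneq (rep_neq0 q) => k0;
    rewrite qk k0 scale0r eqxx.
  rewrite eqEsubv -!memvE memvZ ?memv_line // andbT; apply/vlineP; exists k^-1.
  by rewrite scalerA mulVf // scale1r.
pose v1 := rep p; pose v2 := (h (rep p) (rep q))^*^-1 *: rep q.
have [v3 [k [fr l0 ll1 k1 [{}F2 F3]]]] : exists v3 k,
  [/\ hyperbolic_frame h v1 v2 v3, l != 0,
    l * l^* != 1, `|k| = 1 & F v2 = l^*^-1 *: v2 /\ F v3 = k *: v3].
  apply: (loxodromic_normal_form dimV hsig (m := m)) => //.
  - by rewrite /v2 hZl hZr hq !mulr0.
  - by rewrite /v2 hZr conjV conjCK mulVf.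
  - by rewrite /v2 linearZ /= F2 !scalerA mulrC.
have [mu muE] : exists mu, mu = alpha ^- 3 by eexists.
have mu1 : `|mu| = 1 by rewrite muE normfV normrX al1 expr1n invr1.
have mu0 := unit_neq0 mu1; have k0 := unit_neq0 k1.
have lk : l * l^*^-1 * k = 1.
  rewrite -dF (det_end_trig (a := l) (b := l^*^-1) (c := k) (x := 0) (y :=
    0) (z := 0)
    dimV (free3_basis dimV (frame_free fr))) ?scale0r ?addr0 //.
(* The second predicate excludes both mu and -mu, yet holds for at most one [d], since squaring is
   injective on the cube roots of unity. *)
have [||d d3 /andP[dk1 dk2]] := @pigeonhole_cube_root R (fun d => d * mu * k ==
  1)
    (fun d => (d * mu * k) ^+ 2 == mu ^+ 2).
- move=> d d' _ _ /eqP E /eqP E'; apply: (mulIf mu0); apply: (mulIf k0).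
  by rewrite E E'.
- move=> d d' d3 d'3 /eqP E /eqP E'.
  have E2 : d ^+ 2 = d' ^+ 2.
    apply: (mulIf (_ : (mu * k) ^+ 2 != 0));
      first by rewrite expf_neq0 ?mulf_neq0.
    by rewrite -!exprMn !mulrA E E'.
  transitivity (d ^+ 3 * d); first by rewrite d3 mul1r.
  transitivity ((d ^+ 2) ^+ 2); first by ring.
  by rewrite E2; transitivity (d' ^+ 3 * d'); [ring | rewrite d'3 mul1r].
have d1 := cube_root_norm d3; have dmu1 : `|d * mu| =
  1 by rewrite normrM d1 mu1 mulr1.
have [nu nu1 nuE] := sqrt_unit mu1.
apply: (three_cr_admits a0 d3); rewrite -muE.
have gi := scaled_isometry dmu1 Fi.
have dg : det_end ((d * mu) *: F) = mu ^+ 3.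
  by rewrite (det_endZ dimV) dF mulr1 exprMn d3 mul1r.
have [[h11 h22 h33] [h12 h13 h23]] := fr.
have dc := conj_unit dmu1; have dm0 := unit_neq0 dmu1.
rewrite nuE; apply: (loxodromic_three_cr dimV ndg h11 h22 h33 h12 h13 h23
  (l := d * mu * l) (k := d * mu * k)); rewrite -?nuE //.
- by rewrite muE.
- by rewrite mulf_neq0.
- by rewrite conjM dc mulrACA divff // mul1r.
- by rewrite normrM dmu1 k1 mulr1.
- have lc0 : l^* != 0 by rewrite conjC_eq0.
  rewrite conjM dc; transitivity ((d * mu) ^+ 2 * l^* * (l * l^*^-1 * k));
    first by field.
  rewrite lk mulr1; transitivity (d ^+ 3 * mu ^+ 3 * l^* / (d * mu)).
    by field; rewrite mu0 (unit_neq0 d1).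
  by rewrite d3 mul1r; ring.
- by rewrite scale_lfunE F1 scalerA.
- rewrite scale_lfunE F2 scalerA conjM dc invfM invrK //.
- by rewrite scale_lfunE F3 scalerA.
Qed.

Lemma regular_eigenline (F : 'End(V)) v1 l : regular (Omega_coset F) -> v1 !=
  0 ->
  F v1 = l *: v1 -> forall v, F v = l *: v -> exists c, v = c *: v1.
Proof.
move=> [_ [d _ <-] reg] v10 F1 v Fv.
have mem u : F u = l *: u -> u \in leigenspace (d *: F) (d * l).
  move=> Fu; rewrite memv_ker !(add_lfunE, opp_lfunE, scale_lfunE,
    id_lfunE) Fu scalerA.
  by rewrite subrr.
have ev : leigenvalue (d *: F) (d * l).
  apply/negP => /eqP E; have := mem _ F1; rewrite E memv0.
  exact/negP.
have dim1 := reg _ ev; apply/vlineP.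
have -> : <[v1]>%VS = leigenspace (d *: F) (d * l); last exact: mem.
by apply/eqP; rewrite eqEdim dim1 dim_vline v10 leqnn andbT -memvE mem.
Qed.

Lemma parabolic_decomposition (alpha : R[i]) (F : 'End(V)) : `|alpha| = 1 ->
  alpha ^- 3 != 1 ->
  isometry h F -> det_end F = 1 ->
  regular (Omega_coset F) -> parabolic h (Omega_coset F) ->
  admits_alpha3_decomposition h alpha (Omega_coset F).
Proof.
move=> al1 mun1 Fi dF reg [nid [p fixE] nell].
have a0 := unit_neq0 al1; have Fneg := not_elliptic_eigen Fi nid nell.
have [hp fp] : fixed_isotropic h (Omega_coset F) p by rewrite fixE.
have [l F1] := fixes_coset fp.
have Funiq v a : v != 0 -> h v v = 0 -> F v = a *: v -> exists c, v =
  c *: rep p.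
  move=> v0 hv Fv; have [q qv [c c0 qc]] := exists_line v0.
  have qp : q = p.
    suff : fixed_isotropic h (Omega_coset F) q by rewrite fixE.
    split; first by rewrite /isotropic qc hZl hZr hv !mulr0.
    exact: coset_fixes qv (isometry_eigen_neq0 dimV hsig Fi v0 Fv) Fv.
  by exists c^-1; rewrite -qp qc scalerA mulVf // scale1r.
have Freg := regular_eigenline reg (rep_neq0 p) F1.
have [l1 [w1 [w2 [w3 [fr cases]]]]] :=
  parabolic_normal_form dimV hsig Fi (rep_neq0 p) hp F1 Fneg Funiq Freg.
have [mu muE] : exists mu, mu = alpha ^- 3 by eexists.
have mu1 : `|mu| = 1 by rewrite muE normfV normrX al1 expr1n invr1.
rewrite -muE in mun1.
have mu0 := unit_neq0 mu1; have l0 := unit_neq0 l1.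
have [[h11 h22 h33] [h12 h13 h23]] := fr; have ffr := frame_free fr.
case: cases => [[k [t [[k1 kl t0] [F1' F2 F3]]]]|[t [F1' F2 F3]]]; last first.
  have l3 : l ^+ 3 = 1.
    (* In this order F is triangular. Its determinant gives l^3 = 1, so [l^-1 *: F] is a unipotent
       lift. *)
    have ffr' : free [:: w1; w3; w2].
      by rewrite (perm_free (_ : perm_eq _ [:: w1; w2;
        w3])) // perm_cons (perm_catC [:: w3] [:: w2]).
    rewrite -dF (det_end_trig (a := l) (b := l) (c := l) (x := l) (y := - l)
      (z := l * Complex (- 2^-1) t) dimV (free3_basis dimV ffr'));
        first by ring.
    - by rewrite F1' /vec !scale0r !addr0.
    - by rewrite F3 /vec scale0r addr0 addrC.
    - by rewrite F2 /vec addrC addrCA addrA addrC addrA addrAC.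
  have d3 : l^-1 ^+ 3 = 1 by rewrite exprVn l3 invr1.
  have dmu1 : `|l^-1 * mu| = 1 by rewrite normrM normfV l1 mu1 invr1 mulr1.
  apply: (three_cr_admits a0 d3); rewrite -muE.
  apply: (unipotent_three_cr dimV ndg h11 h22 h33 h12 h13 h23 (tau := t)) => //.
  - exact: scaled_isometry.
  - by rewrite (det_endZ dimV) dF mulr1 exprMn d3 mul1r.
  - by rewrite scale_lfunE F1' vecZ; congr vec; field.
  - by rewrite scale_lfunE F3 vecZ; congr vec; field.
  - by rewrite scale_lfunE F2 vecZ; congr vec; field.
have llk : l * l * k = 1.
  rewrite -dF (det_end_trig (a := l) (b := l) (c := k) (x :=
    l * Complex 0 t) (y := 0)
    (z := 0) dimV (free3_basis dimV ffr)) //.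
  - by rewrite F1' /vec !scale0r !addr0.
  - by rewrite F2 /vec scale0r addr0 addrC.
  - by rewrite F3 /vec !scale0r !addr0 add0r.
have kE : k = (l ^+ 2)^-1 by apply: (mulfI (expf_neq0 2 l0));
  rewrite mulfV ?expf_neq0 // expr2 llk.
have l3 : l ^+ 3 != 1.
  by apply/eqP => l3; apply: kl; rewrite kE -[LHS]mul1r -l3; field.
have [d d3 dRe] := cube_root_Re l1 l3.
have d1 := cube_root_norm d3; have d0 := unit_neq0 d1.
have dmu1 : `|d * mu| = 1 by rewrite normrM d1 mu1 mulr1.
have gi := scaled_isometry dmu1 Fi.
have dg : det_end ((d * mu) *: F) = mu ^+ 3.
  by rewrite (det_endZ dimV) dF mulr1 exprMn d3 mul1r.
apply: (three_cr_admits a0 d3); rewrite -muE.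
have [th thE] : exists th, th = d * l by eexists.
have th1 : `|th| = 1 by rewrite thE normrM d1 l1 mulr1.
have th0 := unit_neq0 th1.
rewrite -thE in dRe.
have g1 : ((d * mu) *: F) w1 = vec w1 w2 w3 (mu * th) 0 0.
  by rewrite scale_lfunE F1' vecZ thE; congr vec; ring.
have g2 : ((d * mu) *: F) w2 = vec w1 w2 w3 (mu * th * Complex 0 t) (mu * th) 0.
  by rewrite scale_lfunE F2 vecZ thE; congr vec; ring.
have g3 : ((d * mu) *: F) w3 = vec w1 w2 w3 0 0 (mu * th ^- 2).
  rewrite scale_lfunE F3 vecZ thE kE; congr vec; try ring.
  transitivity (mu * (d ^+ 3) / (d * l) ^+ 2); first by field; rewrite l0 d0.
  by rewrite d3 mulr1.
move: ((d * mu) *: F) gi dg g1 g2 g3 => g gi dg g1 g2 g3.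
have [nu nu1 nuE] := sqrt_unit mu1.
have thc := conj_unit th1.
have [lt1|lt1] := eqVneq (mu * th) 1.
  have muth : mu = th^-1 by rewrite -[LHS](mulfK th0) lt1 mul1r.
  rewrite nuE; apply: (vertical_three_cr dimV ndg h11 h22 h33 h12 h13 h23 (t :=
    t)); rewrite -?nuE //.
  - rewrite muth -thc; move: dRe; case: (th) => x y; by rewrite conjE.
  - by rewrite g1 lt1.
  - by rewrite g2 lt1 mul1r.
  - by rewrite g3 muth; congr vec; field.
have [kt1|kt1] := eqVneq (mu * th ^- 2) 1.
  have muth : mu = th ^+ 2 by rewrite -[LHS](mulfVK (expf_neq0 2 th0)) kt1
    mul1r.
  (* [th] itself serves as the square root of [mu], and the other eigenvalue mu th is its cube. *)
  rewrite muth; apply: (positive_fixed_three_cr dimV ndg h11 h22 h33 h12 h13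
    h23 (t := t)); rewrite -?muth //.
  - by rewrite g1 muth; congr vec; ring.
  - by rewrite g2 muth; congr vec; ring.
  - by rewrite g3 kt1.
rewrite nuE; apply: (elliptoparabolic_three_cr dimV ndg h11 h22 h33 h12 h13 h23
  (t := t)
  (l := mu * th) (k := mu * th ^- 2)); rewrite -?nuE //.
- by rewrite normrM mu1 th1 mulr1.
- by rewrite normrM normfV normrX th1 expr1n invr1 mulr1 mu1.
have L1 : `|mu * th| = 1 by rewrite normrM mu1 th1 mulr1.
have K1 : `|mu * th ^- 2| = 1 by rewrite normrM normfV normrX th1 expr1n invr1
  mulr1 mu1.
(* After cancelling positive factors the inequality reads Re th < Re th^-2, that is (2x + 1)(x - 1)
   > 0 for x = Re th, which holds because x < -1/2. *)
rewrite (phase_sqr nu1 L1 (th := th)) -?nuE // (phase_sqr nu1 K1 (th :=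
  th ^- 2)) -?nuE //.
have Lre := Re_unit_lt1 L1 lt1; have Kre := Re_unit_lt1 K1 kt1.
rewrite mulrAC (mulrAC (1 - complex.Re (mu * th))) (mulrC (1 - complex.Re (mu *
  th))).
rewrite ltr_pM2l; last by rewrite mulr_gt0 // subr_gt0.
have -> : complex.Re (th ^- 2) = 2 * complex.Re th ^+ 2 - 1.
  rewrite -exprVn -thc; have := norm1P th1; case: (th) => x y;
    rewrite conjE expr2.
  simpc => /= N.
  transitivity (2 * x ^+ 2 - (x ^+ 2 + y ^+ 2)); first by ring.
  by rewrite N.
move: dRe; move: (complex.Re th) => x xlt.
have : 0 < (2 * x + 1) * (x - 1) by rewrite nmulr_rgt0; lra.
lra.
Qed.

End Main.

Theorem proposition6p3 (R : realType) (V : vectType R[i])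
  (h : hermitian_form R V) (dimV : \dim {:V} = 3%N) (hsig : signature_ppm h)
  (alpha : R[i]) (alpha_norm1 : `|alpha| = 1) (alphaNOmega : ~ Omega alpha)
  (f : set 'End(V)) (fPU : PU h f) :
  (regular f /\ parabolic h f) \/ loxodromic h f ->
  admits_alpha3_decomposition h alpha f.
Proof.
move: fPU => [F [dF Fi] <-].
have mun1 : alpha ^- 3 != 1.
  by apply/eqP => E; apply: alphaNOmega; apply/OmegaP;
    rewrite -[LHS]invrK E invr1.
by move=> [[reg par]|lox]; [apply: parabolic_decomposition | apply:
  loxodromic_decomposition].
Qed.
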